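(* Let $R$ be a ring and let $C$ be a $w^+$-tilting left $R$-module such that the class of $\mathrm{G}_C$-flat left $R$-modules is closed under extensions. Then, for a positive integer $n$, the following assertions are equivalent: 1. $\mathrm{G}_C\text{-}\mathrm{FD}(R):=\sup\{\mathrm{G}_C\text{-}\mathrm{fd}_R(M) \mid M \text{ a left } R\text{-module}\}\leq n$. 2. The following two assertions hold: (a) every $\mathcal{I}_{C^+}$-injective right $R$-module has flat dimension at most $n$; (b) $\mathcal{F}_C\text{-}\mathrm{fd}_R(M)\leq n$ for every injective left $R$-module $M$. 3. The following two assertions hold: (a) every $\mathcal{I}_{C^+}$-injective right $R$-module has flat dimension at most $n$; (b) $\mathrm{G}_C\text{-}\mathrm{fd}_R(M)\leq n$ for every injective left $R$-module $M$.
   Context: $R$ is an associative ring with identity, not necessarily commutative; modules are unital. For a left $R$-module $M$, $M^+=\mathrm{Hom}_{\mathbb Z}(M,\mathbb Q/\mathbb Z)$ is its character module (a right $R$-module). A right $R$-module is $\mathcal{I}_{C^+}$-injective if it is isomorphic to a direct summand of a direct product of copies of $C^+$. A left $R$-module $M$ is $\mathcal{F}_C$-flat if $M^+$ is $\mathcal{I}_{C^+}$-injective. A sequence of left $R$-modules is $(\mathcal I_{C^+}(R^{op})\otimes_R-)$-exact if it becomes an exact complex after applying $E\otimes_R-$ for every $\mathcal{I}_{C^+}$-injective right $R$-module $E$. $C$ is $w^+$-tilting if: (i) $\mathrm{Tor}^R_i((C^+)^I,C)=0$ for every set $I$ and every $i\ge 1$; (ii) there is an exact and $(\mathcal I_{C^+}(R^{op})\otimes_R-)$-exact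 sequence $0\to R\to C_{-1}\to C_{-2}\to\cdots$ with all $C_i$ $\mathcal{F}_C$-flat. A left $R$-module $M$ is $\mathrm{G}_C$-flat if there is an exact and $(\mathcal I_{C^+}(R^{op})\otimes_R-)$-exact sequence $\cdots\to F_1\to F_0\to C_{-1}\to C_{-2}\to\cdots$ with each $F_j$ a flat left $R$-module and each $C_i$ $\mathcal{F}_C$-flat, such that $M\cong \mathrm{Im}(F_0\to C_{-1})$. For a class $\mathcal X$ of modules, the $\mathcal X$-resolution dimension of $M$ is the least $n\ge 0$ for which there is an exact sequence $0\to X_n\to\cdots\to X_0\to M\to 0$ with all $X_i\in\mathcal X$, and $\infty$ if no such $n$ exists. $\mathrm{G}_C\text{-}\mathrm{fd}_R(M)$ and $\mathcal{F}_C\text{-}\mathrm{fd}_R(M)$ are the resolution dimensions of $M$ with respect to the classes of $\mathrm{G}_C$-flat and $\mathcal{F}_C$-flat left $R$-modules, respectively. *)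

(* Defs.v *)
From HB Require Import structures.
From mathcomp Require Import all_boot all_order all_algebra.
From mathcomp Require Import generic_quotient ring_quotient.
From mathcomp Require Import boolp functions.
From mathcomp Require Import freeg.

Set Implicit Arguments.
Unset Strict Implicit.
Unset Printing Implicit Defensive.

Import GRing.Theory.
Local Open Scope ring_scope.
Local Open Scope quotient_scope.

(* Left R-modules are [lmodType R]; right R-modules are left modules over the *)
(* converse ring, [lmodType R^c], the right action x r being                  *)
(* [(r : R^c) *: x].                                                          *)

Section Exactness.
Variables U V W : zmodType.

Definition exact_at (f : U -> V) (g : V -> W) : Prop :=
  forall y, g y = 0 <-> exists x, f x = y.

Definition surj (f : U -> V) : Prop := forall y, exists x, f x = y.

End Exactness.

Section ExactSequences.

(* ... -> F 1 -> F 0 -> D 0 -> D 1 -> ..., where D n stands for C_{-(n+1)}. *)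
Definition exact_biseq (F D : nat -> zmodType)
    (dF : forall n, F n.+1 -> F n) (e : F 0 -> D 0)
    (dD : forall n, D n -> D n.+1) : Prop :=
  [/\ forall n, exact_at (dF n.+1) (dF n),
      exact_at (dF 0) e,
      exact_at e (dD 0) &
      forall n, exact_at (dD n) (dD n.+1)].

(* 0 -> A -> D 0 -> D 1 -> ... *)
Definition exact_coseq (A : zmodType) (D : nat -> zmodType)
    (e : A -> D 0) (dD : forall n, D n -> D n.+1) : Prop :=
  [/\ injective e, exact_at e (dD 0) & forall n, exact_at (dD n) (dD n.+1)].

(* ... -> X 1 -> X 0 -> A -> 0 *)
Definition exact_resseq (X : nat -> zmodType) (A : zmodType)
    (d : forall n, X n.+1 -> X n) (e : X 0 -> A) : Prop :=
  [/\ forall n, exact_at (d n.+1) (d n), exact_at (d 0) e & surj e].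

End ExactSequences.

Section Tensor.
Variables (R : pzRingType) (E : lmodType R^c) (M : lmodType R).

Definition balanced (V : zmodType) (f : E -> M -> V) : Prop :=
  [/\ forall x x' y, f (x + x') y = f x y + f x' y,
      forall x y y', f x (y + y') = f x y + f x y' &
      forall x (r : R) y, f ((r : R^c) *: x) y = f x (r *: y)].

Definition tens_gen (x : E) (y : M) : {freeg (E * M)%type} := << (x, y) >>.

Definition tens_rel (H : {pred {freeg (E * M)%type}}) : Prop :=
  [/\ forall x x' y,
        tens_gen (x + x') y - (tens_gen x y + tens_gen x' y) \in H,
      forall x y y',
        tens_gen x (y + y') - (tens_gen x y + tens_gen x y') \in H &
      forall x (r : R) y,
        tens_gen ((r : R^c) *: x) y - tens_gen x (r *: y) \in H].

(* The subgroup of {freeg E * M} generated by the bilinearity relations. *)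
Definition tens_sub : {pred {freeg (E * M)%type}} := fun D =>
  `[< forall H : zmodClosed {freeg (E * M)%type}, tens_rel H -> D \in H >].

Lemma tens_sub_closed : zmod_closed tens_sub.
Proof.
split=> [|a b /asboolP ha /asboolP hb]; apply/asboolP => H hH.
  exact: rpred0.
by apply: rpredB; [exact: ha | exact: hb].
Qed.

HB.instance Definition _ :=
  GRing.isZmodClosed.Build {freeg (E * M)%type} tens_sub tens_sub_closed.

Definition tens : Type := Quotient.quot tens_sub.

HB.instance Definition _ := GRing.Zmodule.on tens.

Definition tensp (x : E) (y : M) : tens := \pi_(Quotient.quot tens_sub) (tens_gen x y).

Lemma tens_rel_sub : tens_rel tens_sub.
Proof. by split=> *; apply/asboolP => H []; auto. Qed.


Lemma tensp_balanced : balanced tensp.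
Proof.
have [h1 h2 h3] := tens_rel_sub.
have hpi D D' : D - D' \in tens_sub ->
    \pi_(Quotient.quot tens_sub) D = \pi_(Quotient.quot tens_sub) D'.
  by move=> h; apply/eqP; rewrite -Quotient.idealrBE.
split=> [x x' y|x y y'|x r y]; rewrite /tensp; last exact/hpi/h3.
  by rewrite (hpi _ _ (h1 x x' y)) raddfD.
by rewrite (hpi _ _ (h2 x y y')) raddfD.
Qed.

(* The additive map on E (x) M induced by f, when f is balanced. *)
Definition tens_lift (V : zmodType) (f : E -> M -> V) (t : tens) : V :=
  fglift (fun p : (E * M)%type => f p.1 p.2 : zmodule V)
    (repr (t : Quotient.quot tens_sub)).

Lemma tens_lift_pi (V : zmodType) (f : E -> M -> V) D : balanced f ->
  tens_lift f (\pi_(Quotient.quot tens_sub) D) =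
  fglift (fun p : (E * M)%type => f p.1 p.2 : zmodule V) D.
Proof.
move=> [f1 f2 f3]; rewrite /tens_lift; case: piP => D' /eqP.
set g := fglift _; have gD : zmod_morphism g by exact: lift_is_additive.
pose G := GRing.isZmodMorphism.Build _ _ g gD.
pose ga : {additive _ -> _} := HB.pack g G.
pose K : {pred {freeg (E * M)%type}} := fun D => ga D == 0.
have Kc : zmod_closed K.
  split=> [|a b]; rewrite -!topredE /= /K ?raddf0 // => /eqP a0 /eqP b0.
  by rewrite raddfB a0 b0 subrr.
pose KG := GRing.isZmodClosed.Build _ K Kc.
pose Ka : zmodClosed {freeg (E * M)%type} := HB.pack K KG.
have gU x y : ga (tens_gen x y) = f x y.
  by rewrite /ga /= /g liftU scale1r.
rewrite -Quotient.idealrBE => /asboolP /(_ Ka) H.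
have : tens_rel Ka.
  split=> *; rewrite -topredE /= /K (raddfB ga) ?(raddfD ga) !gU.
  - by rewrite f1 subrr.
  - by rewrite f2 subrr.
  - by rewrite f3 subrr.
by move=> /H; rewrite -topredE /= /K (raddfB ga) subr_eq0 => /eqP /= ->.
Qed.

Lemma tens_liftE (V : zmodType) (f : E -> M -> V) x y : balanced f ->
  tens_lift f (tensp x y) = f x y.
Proof. by move=> hf; rewrite tens_lift_pi // liftU scale1r. Qed.

Lemma tens_lift_zmod_morphism (V : zmodType) (f : E -> M -> V) :
  balanced f -> zmod_morphism (tens_lift f).
Proof.
move=> hf s t.
rewrite -[s](@reprK _ (Quotient.quot tens_sub)).
rewrite -[t](@reprK _ (Quotient.quot tens_sub)).
rewrite -raddfB !tens_lift_pi //.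
exact: (@lift_is_additive _ _ (zmodule V)).
Qed.

End Tensor.

Arguments tensp {R E M} x y.

Section TensorMap.
Variables (R : pzRingType) (E E' : lmodType R^c) (M M' : lmodType R).
Variables (f : {linear E -> E'}) (g : {linear M -> M'}).

Let fg (x : E) (y : M) : tens E' M' := tensp (f x) (g y).

Let fg_balanced : balanced fg.
Proof.
have [h1 h2 h3] := tensp_balanced E' M'.
by split=> *; rewrite /fg ?(raddfD, linearZ) ?h1 ?h2 ?h3 //= linearZ.
Qed.

Definition tens_map : tens E M -> tens E' M' := tens_lift fg.

Lemma tens_mapE x y : tens_map (tensp x y) = tensp (f x) (g y).
Proof. exact: tens_liftE. Qed.

HB.instance Definition _ := GRing.isZmodMorphism.Build _ _ tens_map
  (tens_lift_zmod_morphism fg_balanced).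

End TensorMap.

Arguments tens_map {R E E' M M'} f g _.

Notation "E '⊗m' g" := (tens_map (idfun : {linear E -> E}) g)
  (at level 40, g at level 39).

Section CharacterModule.

Definition ratZ : {pred rat} := fun q => q \is a Num.int.

Lemma ratZ_closed : zmod_closed ratZ.
Proof. by split; [exact: rpred0 | move=> a b; exact: rpredB]. Qed.

HB.instance Definition _ := GRing.isZmodClosed.Build rat ratZ ratZ_closed.

Definition QZ : Type := Quotient.quot ratZ.
HB.instance Definition _ := GRing.Zmodule.on QZ.

Variables (R : pzRingType) (M : lmodType R).

Definition char_pred : {pred M -> QZ} := fun f => `[< zmod_morphism f >].

Lemma char_pred_closed : zmod_closed char_pred.
Proof.
split=> [|f g /asboolP hf /asboolP hg]; apply/asboolP => x y.
  by rewrite subrr.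
by rewrite !fctE hf hg !opprD !opprK addrACA.
Qed.

HB.instance Definition _ :=
  GRing.isZmodClosed.Build (M -> QZ) char_pred char_pred_closed.

(* M^+ = Hom_Z(M, Q/Z) *)
Record charmod : Type := Charmod {
  charmod_fun :> M -> QZ;
  charmodP : charmod_fun \in char_pred }.

HB.instance Definition _ := [isSub for charmod_fun].
HB.instance Definition _ := [Choice of charmod by <:].
HB.instance Definition _ := [SubChoice_isSubZmodule of charmod by <:].

Lemma charmod_scale_subproof (r : R^c) (f : charmod) :
  (fun x => f ((r : R) *: x)) \in char_pred.
Proof.
have /asboolP hf := charmodP f.
by apply/asboolP => x y; rewrite scalerBr hf.
Qed.

(* (f r)(x) = f (r x) *)
Definition charmod_scale (r : R^c) (f : charmod) : charmod :=
  Charmod (charmod_scale_subproof r f).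

End CharacterModule.

Section CharacterModuleLmod.
Variables (R : pzRingType) (M : lmodType R).

Lemma charmod_addE (f g : charmod M) x : (f + g) x = f x + g x.
Proof. by []. Qed.

Lemma charmod_ext (f g : charmod M) : f =1 g -> f = g.
Proof. by move=> /funext h; apply: val_inj. Qed.

Lemma charmod_scaleA (a b : R^c) (f : charmod M) :
  charmod_scale a (charmod_scale b f) = charmod_scale (a * b) f.
Proof. by apply: charmod_ext => x /=; rewrite scalerA. Qed.

Lemma charmod_scale1 : left_id (1 : R^c) (@charmod_scale R M).
Proof. by move=> f; apply: charmod_ext => x /=; rewrite scale1r. Qed.

Lemma charmod_scaleDr : right_distributive (@charmod_scale R M) +%R.
Proof. by move=> a f g; apply: charmod_ext => x. Qed.

Lemma charmod_scaleDl (f : charmod M) :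
  {morph (fun a : R^c => charmod_scale a f) : a b / a + b}.
Proof.
move=> a b; apply: charmod_ext => x; rewrite charmod_addE /= scalerDl.
have /asboolP hf := charmodP f.
pose fa : {additive M -> QZ} :=
  HB.pack (charmod_fun f) (GRing.isZmodMorphism.Build _ _ _ hf).
exact: (raddfD fa).
Qed.

HB.instance Definition _ := GRing.Zmodule_isLmodule.Build R^c (charmod M)
  charmod_scaleA charmod_scale1 charmod_scaleDr charmod_scaleDl.

End CharacterModuleLmod.

Section ModuleClasses.
Variable R : pzRingType.
Implicit Types M N P A B : lmodType R.

Definition lin_iso M N : Prop := exists f : {linear M -> N}, bijective f.

Definition projective P : Prop :=
  forall A B (p : {linear A -> B}) (f : {linear P -> B}),
  surj p -> exists g : {linear P -> A}, forall x, p (g x) = f x.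

Definition injective_mod M : Prop :=
  forall A B (i : {linear A -> B}) (f : {linear A -> M}),
  injective i -> exists g : {linear B -> M}, forall x, g (i x) = f x.

(* X_0, ..., X_n are X 0, ..., X n; the modules X i with i > n are zero. *)
Definition has_resolution (cX : lmodType R -> Prop) M (n : nat) : Prop :=
  exists (X : nat -> lmodType R) (d : forall i, {linear X i.+1 -> X i})
         (e : {linear X 0 -> M}),
  [/\ forall i, (i <= n)%N -> cX (X i),
      forall i, (n < i)%N -> forall x : X i, x = 0 &
      exact_resseq d e].

Definition ext_closed (cX : lmodType R -> Prop) : Prop :=
  forall A B N (f : {linear A -> B}) (g : {linear B -> N}),
  injective f -> exact_at f g -> surj g -> cX A -> cX N -> cX B.

End ModuleClasses.

Section Dimensions.

(* The extended natural numbers are [option nat], with [None] for infinity. *)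
Definition least (P : nat -> Prop) : option nat :=
  if pselect (exists n, `[< P n >]) is left h then Some (ex_minn h) else None.

Definition dim_le (d : option nat) (n : nat) : Prop :=
  if d is Some k then (k <= n)%N else False.

Definition dim_sup (I : Type) (d : I -> option nat) : option nat :=
  least (fun n => forall i, dim_le (d i) n).

Definition resdim (R : pzRingType) (cX : lmodType R -> Prop) (M : lmodType R)
  : option nat := least (has_resolution cX M).

End Dimensions.

Section Flatness.
Variable R : pzRingType.

Definition flat_left (M : lmodType R) : Prop :=
  forall (A B : lmodType R^c) (f : {linear A -> B}),
  injective f -> injective (tens_map f (idfun : {linear M -> M})).

Definition flat_right (E : lmodType R^c) : Prop :=
  forall (A B : lmodType R) (f : {linear A -> B}),
  injective f -> injective (E ⊗m f).

Definition flat_dim_right (E : lmodType R^c) : option nat :=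
  resdim flat_right E.

(* Tor^R_i(E, M) = 0: for a projective resolution P of M, the homology of     *)
(* E (x) P at E (x) P_i vanishes; this does not depend on the choice of P.    *)
Definition Tor_eq0 (i : nat) (E : lmodType R^c) (M : lmodType R) : Prop :=
  forall (P : nat -> lmodType R) (d : forall j, {linear P j.+1 -> P j})
         (e : {linear P 0 -> M}),
  (forall j, projective (P j)) -> exact_resseq d e ->
  match i with
  | 0 => surj (E ⊗m d 0)
  | j.+1 => exact_at (E ⊗m d j.+1) (E ⊗m d j)
  end.

End Flatness.

Section RelativeClasses.
Variables (R : pzRingType) (C : lmodType R).

Definition IC_injective (E : lmodType R^c) : Prop :=
  exists (I : Type) (E' : lmodType R^c), lin_iso (E * E')%type (I -> charmod C).

Definition FC_flat (M : lmodType R) : Prop := IC_injective (charmod M).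

Definition w_plus_tilting : Prop :=
  (forall (I : Type) (i : nat), (1 <= i)%N -> Tor_eq0 i (I -> charmod C) C) /\
  exists (D : nat -> lmodType R) (e : {linear R^o -> D 0})
         (dD : forall n, {linear D n -> D n.+1}),
  [/\ forall n, FC_flat (D n),
      exact_coseq e dD &
      forall E, IC_injective E ->
        exact_coseq (E ⊗m e) (fun n => E ⊗m dD n)].

(* An isomorphism M ~ Im e is given by an injective j : M -> D 0 whose image  *)
(* is that of e.                                                              *)
Definition GC_flat (M : lmodType R) : Prop :=
  exists (F D : nat -> lmodType R) (dF : forall n, {linear F n.+1 -> F n})
         (e : {linear F 0 -> D 0}) (dD : forall n, {linear D n -> D n.+1}),
  [/\ forall n, flat_left (F n),
      forall n, FC_flat (D n),
      exact_biseq dF e dD,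
      forall E, IC_injective E ->
        exact_biseq (fun n => E ⊗m dF n) (E ⊗m e) (fun n => E ⊗m dD n) &
      exists j : {linear M -> D 0}, injective j /\
        forall y, (exists z, j z = y) <-> (exists x, e x = y)].

Definition GC_fd (M : lmodType R) : option nat := resdim GC_flat M.
Definition FC_fd (M : lmodType R) : option nat := resdim FC_flat M.
Definition GC_FD : option nat := dim_sup GC_fd.

End RelativeClasses.

(* Main.v *)
(** Tor is only used through its vanishing, which is read off the dual complexes
    of balanced maps into Q/Z: the functors [bal P -] are exact for flat [P],
    so all long exact sequences reduce to diagram chases.

    A module is G_C-flat iff its higher Tor against the I_{C^+}-injectives
    vanishes and it embeds into an F_C-flat module with G_C-flat cokernel, and
    these two properties determine the G_C-flat modules coinductively.

    1 => 2.  Dimension shifting gives (a).  For (b), Auslander-Buchweitz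
    approximation of an injective [M] gives [0 -> K -> G -> M -> 0] with [G]
    G_C-flat and [K] of F_C-dimension < n; embed [G] in an F_C-flat [X] with
    G_C-flat cokernel [G'].  As [M] is injective, it is a summand of [X / K],
    so Tor_1(G^+, G') = 0, which splits [X^+ -> G^+]: [G] is F_C-flat.

    3 => 1.  Let [M] be arbitrary and embed it in an injective [J].  By the
    horseshoe lemma the n-th syzygy of [M] embeds into one of [J], which is
    G_C-flat, with cokernel again an n-th syzygy.  By (a) the higher Tor of
    n-th syzygies vanishes, and coinduction applies: closure under extensions
    allows one to replace the G_C-flat modules by F_C-flat ones. *)

From HB Require Import structures.
From mathcomp Require Import all_boot all_order all_algebra.
From mathcomp Require Import generic_quotient ring_quotient freeg.
From mathcomp Require Import boolp classical_sets functions.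
Require Import Defs.

Set Implicit Arguments.
Unset Strict Implicit.
Unset Printing Implicit Defensive.

Import Order.TTheory GRing.Theory Num.Theory.
Local Open Scope ring_scope.
Local Open Scope quotient_scope.
Local Open Scope classical_set_scope.

(** [QZ] is an injective cogenerator of abelian groups, so injectivity and exactness of maps between
    tensor products amount to surjectivity and exactness of the dual maps between groups of balanced
    functions, where preimages can be written down pointwise. The main obstacle is that G_C-flatness
    asks for an infinite coresolution that stays exact after tensoring. [GC_coind] builds it by
    dependent choice from one-step embeddings, so a closure property comes down to finding a class
    that contains the module and is stable under the cokernel of one embedding into an F_C-flat
    module. Syzygies use covers that are projective, for lifting, and G_C-flat, for counting
    dimensions. Free modules qualify because the second tilting condition makes [R] itself G_C-flat.
    In 3 => 1 the n-th syzygy of [M] is fixed in advance, and the horseshoe lemma dictates those of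
    [J] and of [J / M]. Hence every n-th syzygy of [J], not just some, must be G_C-flat, and this is
    where Schanuel's lemma enters. *)

Section Morphisms.

Definition mk_add (U V : zmodType) (f : U -> V) (h : zmod_morphism f) :
  {additive U -> V} := HB.pack f (GRing.isZmodMorphism.Build U V f h).

Definition mk_lin (R : pzRingType) (U V : lmodType R) (f : U -> V)
  (h : linear f) : {linear U -> V} :=
    HB.pack f (GRing.isLinear.Build R U V _ f h).

End Morphisms.

Arguments mk_add {U V f} h /.
Arguments mk_lin {R U V f} h /.

(** * Injectivity of Q/Z *)

Section DivisibleQZ.

Lemma QZ_divisible (q : QZ) (m : int) : m != 0 -> exists p : QZ, p *~ m = q.
Proof.
move=> m0; rewrite -[q](@reprK _ (Quotient.quot ratZ)); set x := repr _.
exists (\pi_(Quotient.quot ratZ) (x / m%:~R)).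
rewrite -raddfMz -mulrzl mulrC divfK //.
by rewrite intr_eq0.
Qed.

(** The class of [1/m]: a possible nonzero value of a character at an element of order [m]. *)
Lemma QZ_torsion (m : nat) : (1 < m)%N -> exists2 q : QZ, q != 0 & q *+ m = 0.
Proof.
move=> m1; have m0 : (m%:R : rat) != 0 by rewrite pnatr_eq0 -lt0n ltnW.
exists (\pi_(Quotient.quot ratZ) (m%:R^-1)).
  rewrite -(raddf0 (\pi_(Quotient.quot ratZ))) -Quotient.idealrBE subr0.
  apply/negP => /intrP [z hz].
  have : z * m%:Z = 1.
    apply: (@intr_inj rat); rewrite rmorphM /= -hz -natz mulrz_nat.
    by rewrite mulVf.
  move=> /(congr1 absz); rewrite abszM /= => /eqP.
  by rewrite muln_eq1 andbC; case: eqP m1 => [->|].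
rewrite -raddfMn; apply/eqP.
rewrite -(raddf0 (\pi_(Quotient.quot ratZ))) -Quotient.idealrBE subr0.
by rewrite -[_^-1 *+ m]mulr_natl mulfV // unfold_in /= rpred1.
Qed.

End DivisibleQZ.

Section QZInjective.
Variable V : zmodType.

(** The graph of a homomorphism to [QZ] defined on a subgroup of [V]; the last clause makes it
    single-valued. For graphs, extension is inclusion and the union of a nonempty chain is again a
    graph, which suits Zorn's lemma. *)
Definition partial_hom (G : set (V * QZ)) : Prop :=
  [/\ G (0, 0), forall p q, G p -> G q -> G (p - q) &
      forall q, G (0, q) -> q = 0].

Section PartialHom.
Variables (G : set (V * QZ)) (hG : partial_hom G).

Lemma partial_homN p : G p -> G (- p).
Proof. by case: hG => g0 gB _ gp; rewrite -[- p]add0r; apply: gB. Qed.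

Lemma partial_homD p q : G p -> G q -> G (p + q).
Proof.
move=> gp gq; rewrite -[q]opprK.
by case: hG => _ gB _; apply: gB => //; apply: partial_homN.
Qed.

Lemma partial_homMn p n : G p -> G (p *+ n).
Proof.
move=> gp; elim: n => [|n IH]; first by rewrite mulr0n; case: hG.
by rewrite mulrS; apply: partial_homD.
Qed.

Lemma partial_homMz p z : G p -> G (p *~ z).
Proof.
move=> gp; case: z => n; first exact: partial_homMn.
by apply: partial_homN; apply: partial_homMn.
Qed.

Lemma partial_hom_uniq x q q' : G (x, q) -> G (x, q') -> q = q'.
Proof.
case: hG => _ gB g1 h h'; apply/eqP; rewrite -subr_eq0; apply/eqP/g1.
by have := gB _ _ h h'; rewrite /GRing.add /= /add_pair /= subrr.
Qed.

End PartialHom.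

Lemma pairMz (U W : zmodType) (a : U) (c : W) z :
  (a, c) *~ z = (a *~ z, c *~ z).
Proof.
rewrite [LHS]surjective_pairing; congr (_, _).
  exact: (raddfMz (@fst U W)).
exact: (raddfMz (@snd U W)).
Qed.

(** The new graph is [G] plus the integer multiples of [(v, q)]. Agreement of [q] with the values
    already prescribed on multiples of [v] keeps it single-valued. *)
Lemma partial_hom_extend1 (G : set (V * QZ)) (v : V) (q : QZ) :
  partial_hom G -> (forall z x, G (v *~ z, x) -> x = q *~ z) ->
  partial_hom [set p | exists z, G (p.1 - v *~ z, p.2 - q *~ z)].
Proof.
move=> hG hq; split => [|p p' [z hz] [z' hz'] | x [z /= hz]].
- by exists 0; rewrite /= !subr0; case: hG.
- exists (z - z'); have [_ gB _] := hG.
  have := gB _ _ hz hz'.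
  suff -> : (p.1 - v *~ z, p.2 - q *~ z) - (p'.1 - v *~ z', p'.2 - q *~ z') =
    ((p - p').1 - v *~ (z - z'), (p - p').2 - q *~ (z - z')) by [].
  by rewrite [LHS]surjective_pairing; congr (_, _);
    rewrite /= mulrzBr !opprD !opprK addrACA.
- have := partial_homN hG hz.
  rewrite -[- _]/(- (0 - v *~ z), - (x - q *~ z)) sub0r opprK => /hq /eqP.
  by rewrite opprB subr_eq addrC -subr_eq subrr eq_sym => /eqP.
Qed.

(** The integers [z] with [v *~ z] in the domain form an ideal. If it is zero, any [q] serves;
    otherwise it is generated by its least positive element, and divisibility of [QZ] allows the
    value there to be divided by that integer. *)
Lemma partial_hom_value (G : set (V * QZ)) (v : V) : partial_hom G ->
  exists q, forall z x, G (v *~ z, x) -> x = q *~ z.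
Proof.
move=> hG; have [_ gB g1] := hG.
pose P m := `[< exists x, G (v *+ m.+1, x) >].
have [[m0 Pm0]|noP] := pselect (exists m, P m); last first.
  exists 0 => z x; rewrite mul0rz; case: z => [[|n]|n] h.
  - exact: g1.
  - by case: noP; exists n; apply/asboolP; exists x.
  - case: noP; exists n; apply/asboolP; exists (- x).
    by rewrite -[v *+ _]opprK; apply: (partial_homN hG h).
have exP : exists m, P m by exists m0.
case: (ex_minnP exP) => m /asboolP [y hy] mmin.
have [q hq] := @QZ_divisible y m.+1%:Z isT.
exists q => z x h.
have hz := divz_eq z m.+1%:Z; set k := divz z _ in hz; set r := modz z _ in hz.
(* The remainder of [z] modulo the generator also leads into the domain, so minimality will force it
   to be zero. *)
have hr : G (v *~ r, x - y *~ k).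
  have := gB _ _ h (partial_homMz hG k hy); rewrite pairMz.
  suff <- : v *~ z - v *~ m.+1%:Z *~ k = v *~ r by [].
  by rewrite {1}hz mulrzDr addrC mulrC -mulrzA addrA addNr add0r.
have r0 : 0 <= r by apply: modz_ge0.
have rm : r < m.+1%:Z by apply: ltz_pmod.
have re : r = 0.
  case: (r) r0 rm hr => [[|j]|//] // _ jm hj.
  have /mmin : P j by apply/asboolP; exists (x - y *~ k).
  by move: jm; rewrite ltz_nat ltnS => jm mj; have := leq_trans jm mj;
    rewrite ltnn.
move: hr; rewrite re mulr0z => /g1 /eqP; rewrite subr_eq0 => /eqP ->.
by rewrite hz re addr0 -hq mulrC mulrzA.
Qed.

Lemma partial_hom_extends (G : set (V * QZ)) : partial_hom G ->
  exists f : {additive V -> QZ}, forall p, G p -> f p.1 = p.2.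
Proof.
move=> hG.
(* Zorn's lemma is applied to the sets whose union with [G] is a graph: the empty chain, whose union
   is empty, is then no exception, and the result extends [G]. *)
have [|A [hA Amax]] := @Zorn_bigcup _ (fun H => partial_hom (G `|` H)).
  move=> F FP Ftot; set B := G `|` _.
  have BE p q : B p -> B q ->
      exists2 H, partial_hom H /\ H `<=` B & H p /\ H q.
    have sub H : F H -> G `|` H `<=` B.
      by move=> FH x [Gx|Hx]; [left|right; exists H].
    move=> [Gp|[H FH Hp]] [Gq|[H' FH' Hq]].
    - by exists G => //; split => // x; left.
    - exists (G `|` H'); first by split; [apply: FP|apply: sub].
      by split; [left|right].
    - exists (G `|` H); first by split; [apply: FP|apply: sub].
      by split; [right|left].
    - have [HH'|H'H] := Ftot _ _ FH FH'.
        exists (G `|` H'); first by split; [apply: FP|apply: sub].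
        by split; right => //; apply: HH'.
      exists (G `|` H); first by split; [apply: FP|apply: sub].
      by split; right => //; apply: H'H.
  split.
  - by left; case: hG.
  - move=> p q Bp Bq; have [H [[_ hB _] HB] [Hp Hq]] := BE _ _ Bp Bq.
    exact/HB/hB.
  - by move=> q Bq; have [H [[_ _ h1] HB] [Hp Hq]] := BE _ _ Bq Bq; apply: h1.
have dom v : exists q, (G `|` A) (v, q).
  have [q hq] := partial_hom_value v hA.
  have hB := partial_hom_extend1 hA hq; set B := [set p | _] in hB.
  have subB : G `|` A `<=` B.
    by move=> p Ap; exists 0; rewrite !mulr0z !subr0 -surjective_pairing.
  have Bv : B (v, q) by exists 1; rewrite /= !mulr1z !subrr; case: hA.
  apply: contrapT => nv; apply: (Amax B); last first.
    have -> // : G `|` B = B.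
    by apply/seteqP; split => p; [case=> // Gp; apply: subB; left | right].
  split; first by move=> p Ap; apply: subB; right.
  by move=> BA; apply: nv; exists q; right; apply: BA.
have [f hf] := choice dom; have [_ gB _] := hA.
have fadd : zmod_morphism f.
  move=> x y; apply: (partial_hom_uniq hA (hf _)).
  exact: (gB _ _ (hf x) (hf y)).
exists (mk_add fadd) => p Gp; apply: (partial_hom_uniq hA (hf _)).
by rewrite -surjective_pairing; left.
Qed.

Lemma QZ_cogenerator (v : V) : v != 0 -> exists f :
  {additive V -> QZ}, f v != 0.
Proof.
move=> v0.
have hG : partial_hom [set (0 : V * QZ)].
  by split=> // [p q -> ->|q [->]] //; rewrite /set1 /= subrr.
(* Every integer that kills [v] must kill [q]: the order of [q] divides that of [v], and is 2 if [v]
   has infinite order. *)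
have [q q0 hq] : exists2 q : QZ, q != 0 &
    forall z x, [set (0 : V * QZ)] (v *~ z, x) -> x = q *~ z.
  have [[m /asboolP hm]|noP] := pselect (exists m, `[< v *+ m.+1 = 0 >]).
    have exP : exists m, v *+ m.+1 == 0 by exists m; apply/eqP.
    case: (ex_minnP exP) => -[|m'] /eqP hm' mmin.
      by move: v0; rewrite -hm' mulr1n eqxx.
    have [q q0 hq] := @QZ_torsion m'.+2 isT.
    exists q => // z x [hz ->].
    have hz' := divz_eq z m'.+2%:Z.
    set k := divz z _ in hz'; set r := modz z _ in hz'.
    have r0 : 0 <= r by apply: modz_ge0.
    have rm : r < m'.+2%:Z by apply: ltz_pmod.
    have kz (W : zmodType) (w : W) : w *+ m'.+2 = 0 -> w *~ z = w *~ r.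
      move=> hw; rewrite hz' mulrzDr mulrC mulrzA.
      by rewrite [w *~ m'.+2]hw mul0rz add0r.
    rewrite kz //; rewrite kz // in hz.
    case: (r) r0 rm hz => [[|j]|//] // _ jm hj.
    have /mmin : v *+ j.+1 == 0 by apply/eqP.
    by move: jm; rewrite ltz_nat ltnS => jm /(leq_trans jm); rewrite ltnn.
  have [q q0 hq] := @QZ_torsion 2 isT.
  exists q => // z x [hz ->]; case: z hz => [[|n]|n] // hz; case: noP; exists n.
    exact/asboolP.
  by apply/asboolP; apply: oppr_inj; rewrite oppr0.
have [f hf] := partial_hom_extends (partial_hom_extend1 hG hq).
by exists f; rewrite (hf (v, q)) //; exists 1; rewrite /= !mulr1z !subrr.
Qed.

End QZInjective.

Lemma QZ_injective (U V : zmodType) (i : {additive U -> V})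
  (f : {additive U -> QZ}) : injective i ->
  exists g : {additive V -> QZ}, forall x, g (i x) = f x.
Proof.
move=> inj.
have hG : partial_hom [set p | exists x, (i x, f x) = p].
  split; first by exists 0; rewrite !raddf0.
    by move=> p q [x <-] [y <-]; exists (x - y); rewrite !raddfB.
  by move=> q [x [h <-]]; rewrite (_ : x = 0) ?raddf0 //; apply: inj;
    rewrite raddf0.
have [g hg] := partial_hom_extends hG.
by exists g => x; rewrite (hg (i x, f x)) //; exists x.
Qed.

(** * Module constructions *)

Section Submodules.
Variables (R : pzRingType) (M : lmodType R).

Section MkSubmod.
Variables (P : M -> Prop) (P0 : P 0).
Hypothesis PD : forall a x y, P x -> P y -> P (a *: x + y).

Let S : {pred M} := fun x => `[< P x >].

Lemma mk_submod_closed : submod_closed S.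
Proof.
split; first exact/asboolP.
by move=> a x y /asboolP Px /asboolP Py; apply/asboolP/PD.
Qed.

Definition mk_submod : submodClosed M :=
  HB.pack S (GRing.isSubmodClosed.Build R M S mk_submod_closed).

Lemma mem_submod x : (x \in mk_submod) <-> P x.
Proof. by rewrite unfold_in /=; split => /asboolP. Qed.

End MkSubmod.

Variable S : submodClosed M.

Record submodule : Type := Submodule {
  submodule_val :> M;
  submoduleP : submodule_val \in S }.

HB.instance Definition _ := [isSub for submodule_val].
HB.instance Definition _ := [Choice of submodule by <:].
HB.instance Definition _ := [SubChoice_isSubLmodule of submodule by <:].

Definition submodule_incl : {linear submodule -> M} :=
  @mk_lin R submodule M val (fun a x y => erefl).

Definition submod_zmod : zmodClosed M := HB.pack (S : {pred M})
  (GRing.isZmodClosed.Build M (S : {pred M})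
    (GRing.submod_closedB (GRing.submodClosedP S))).

Definition quotmod : Type := Quotient.quot submod_zmod.
HB.instance Definition _ := GRing.Zmodule.on quotmod.

Definition quot_pi (x : M) : quotmod := \pi_(Quotient.quot submod_zmod) x.

Lemma quot_pi_is_additive : zmod_morphism quot_pi.
Proof. by move=> x y; rewrite /quot_pi raddfB. Qed.

HB.instance Definition _ :=
  GRing.isZmodMorphism.Build M quotmod quot_pi quot_pi_is_additive.

Lemma quot_pi_surj : surj quot_pi.
Proof.
by move=> y; exists (repr (y : Quotient.quot submod_zmod)); apply: reprK.
Qed.

Lemma quot_pi_eq0 x : quot_pi x = 0 <-> x \in S.
Proof.
rewrite -(raddf0 quot_pi); split => [/eqP|h].
  by rewrite /quot_pi -Quotient.idealrBE subr0.
by apply/eqP; rewrite /quot_pi -Quotient.idealrBE subr0.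
Qed.

Definition quot_scale (r : R) (y : quotmod) : quotmod :=
  quot_pi (r *: repr (y : Quotient.quot submod_zmod)).

Lemma quot_scaleE r x : quot_scale r (quot_pi x) = quot_pi (r *: x).
Proof.
apply/eqP; rewrite /quot_scale -subr_eq0 -raddfB -scalerBr; apply/eqP.
apply/quot_pi_eq0/rpredZ/quot_pi_eq0; rewrite raddfB.
by apply/eqP; rewrite subr_eq0; apply/eqP/reprK.
Qed.

Lemma quot_scaleA a b y : quot_scale a (quot_scale b y) = quot_scale (a * b) y.
Proof. by case: (quot_pi_surj y) => x <-; rewrite !quot_scaleE scalerA. Qed.

Lemma quot_scale1 : left_id 1 quot_scale.
Proof.
by move=> y; case: (quot_pi_surj y) => x <-; rewrite quot_scaleE scale1r.
Qed.

Lemma quot_scaleDr : right_distributive quot_scale +%R.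
Proof.
move=> a y y'; case: (quot_pi_surj y) => x <-; case: (quot_pi_surj y') => x' <-.
by rewrite -raddfD !quot_scaleE scalerDr raddfD.
Qed.

Lemma quot_scaleDl y : {morph quot_scale^~ y : a b / a + b}.
Proof.
move=> a b; case: (quot_pi_surj y) => x <-.
by rewrite !quot_scaleE scalerDl raddfD.
Qed.

HB.instance Definition _ := GRing.Zmodule_isLmodule.Build R quotmod
  quot_scaleA quot_scale1 quot_scaleDr quot_scaleDl.

Lemma quot_pi_linear : linear quot_pi.
Proof.
by move=> a x y; rewrite raddfD; congr (_ + _); apply/esym/(quot_scaleE a x).
Qed.

End Submodules.

Section LinearConstructions.
Variable R : pzRingType.
Implicit Types A B D E N M : lmodType R.

Definition ses (A B N : zmodType) (f : A -> B) (g : B -> N) : Prop :=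
  [/\ injective f, exact_at f g & surj g].

Lemma factor_inj A B M (i : {linear A -> B}) (u : {linear M -> B}) :
  injective i -> (forall x, exists a, i a = u x) ->
  exists v : {linear M -> A}, forall x, i (v x) = u x.
Proof.
move=> inj /choice [v hv].
have lv : linear v by move=> a x y; apply: inj; rewrite hv !linearP !hv.
by exists (mk_lin lv).
Qed.

Lemma factor_surj A B M (p : {linear A -> B}) (u : {linear A -> M}) :
  surj p -> (forall x, p x = 0 -> u x = 0) ->
  exists v : {linear B -> M}, forall x, v (p x) = u x.
Proof.
move=> /choice [s hs] ker.
have key x y : p x = p y -> u x = u y.
  move=> e; apply/eqP; rewrite -subr_eq0 -raddfB; apply/eqP/ker.
  by rewrite linearB e subrr.
have lv : linear (u \o s).
  by move=> a x y /=; rewrite -linearP; apply: key; rewrite linearP !hs.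
by exists (mk_lin lv) => x; apply: key; rewrite hs.
Qed.

Lemma ker_exists A B (g : {linear A -> B}) :
  exists (K : lmodType R) (i : {linear K -> A}), injective i /\ exact_at i g.
Proof.
have P0 : g 0 = 0 by rewrite raddf0.
have PD a x y : g x = 0 -> g y = 0 -> g (a *: x + y) = 0.
  by move=> hx hy; rewrite linearP hx hy scaler0 addr0.
exists (submodule (@mk_submod R A _ P0 PD)), (submodule_incl _); split.
  exact: val_inj.
move=> y; split => [hy|[x <-]];
  last exact: (mem_submod P0 PD _).1 (submoduleP x).
by exists (Submodule ((mem_submod P0 PD _).2 hy)).
Qed.

Lemma coker_exists A B (f : {linear A -> B}) :
  exists (N : lmodType R) (p : {linear B -> N}), surj p /\ exact_at f p.
Proof.
have P0 : exists x, f x = 0 by exists 0; rewrite raddf0.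
have PD a y y' : (exists x, f x = y) -> (exists x, f x = y') ->
    exists x, f x = a *: y + y'.
  by move=> [x <-] [x' <-]; exists (a *: x + x'); rewrite linearP.
pose S := @mk_submod R B _ P0 PD.
exists (quotmod S), (mk_lin (@quot_pi_linear R B S)); split.
  exact: quot_pi_surj.
by move=> y; rewrite quot_pi_eq0 mem_submod.
Qed.

Lemma ses_of_surj A B (g : {linear A -> B}) : surj g ->
  exists (K : lmodType R) (i : {linear K -> A}), ses i g.
Proof. by have [K [i [hi e]]] := ker_exists g; exists K, i. Qed.

Lemma ses_of_inj A B (f : {linear A -> B}) : injective f ->
  exists (N : lmodType R) (p : {linear B -> N}), ses f p.
Proof. by have [N [p [hp e]]] := coker_exists f; exists N, p. Qed.

Lemma image_exists A B (u : {linear A -> B}) :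
  exists (I : lmodType R) (p : {linear A -> I}) (i : {linear I -> B}),
  [/\ surj p, injective i & forall x, i (p x) = u x].
Proof.
have [N [q [_ e]]] := coker_exists u; have [I [i [inj e']]] := ker_exists q.
have [|p hp] := @factor_inj _ _ _ i u inj.
  by move=> x; apply/e'/e; exists x.
exists I, p, i; split => // y.
have /e [x hx] : q (i y) = 0 by apply/e'; exists y.
by exists x; apply: inj; rewrite hp.
Qed.

End LinearConstructions.

(** * Third isomorphism theorem and pushouts of short exact sequences *)

Section Diagrams.
Variable R : pzRingType.
Implicit Types A B D E N M : lmodType R.

Lemma inj_ker0 A B (f : {linear A -> B}) :
  (forall x, f x = 0 -> x = 0) -> injective f.
Proof.
move=> h x y e; apply/eqP; rewrite -subr_eq0; apply/eqP/h.
by rewrite linearB e subrr.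
Qed.

Lemma exact_comp0 (U V W : zmodType) (f : U -> V) (g : V -> W) x :
  exact_at f g -> g (f x) = 0.
Proof. by move=> e; apply/e; exists x. Qed.

(* Applied to [A <= B <= D]: the new sequences are those of [D / A]. *)
Lemma ses_noether A B N D E (f : {linear A -> B}) (g : {linear B -> N})
    (h : {linear B -> D}) (k : {linear D -> E}) : ses f g -> ses h k ->
  exists (N' : lmodType R) (g' : {linear D -> N'}) (h' : {linear N -> N'})
    (k' : {linear N' -> E}),
  [/\ ses (h \o f) g', ses h' k' & forall x, h' (g x) = g' (h x)].
Proof.
move=> [injf ef sg] [injh eh sk].
have injhf : injective (h \o f) := inj_comp injh injf.
have [N' [g' sg']] := @ses_of_inj R A D (h \o f) injhf.
have [_ eg' surjg'] := sg'.
have [|h' hh'] := @factor_surj R B N N' g (g' \o h) sg.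
  by move=> x /ef [a <-] /=; apply/eg'; exists a.
have [|k' hk'] := @factor_surj R D N' E g' k surjg'.
  by move=> x /eg' [a <-] /=; apply: exact_comp0.
exists N', g', h', k'; split => //; split.
- apply: inj_ker0 => x; case: (sg x) => b <-;
  rewrite hh' => /= /eg' [a /= /injh <-].
  exact: exact_comp0.
- move=> y; split => [|[x <-]].
    case: (surjg' y) => d <-; rewrite hk' => /eh [b <-].
    by exists (g b); rewrite hh'.
  by case: (sg x) => b <-; rewrite hh' hk'; apply: exact_comp0.
- by move=> e; case: (sk e) => d <-; exists (g' d).
Qed.

(** [P] is the quotient of [B * D] by the pairs [(f a, - h a)]; the pushout of two injections keeps
    both cokernels. *)
Lemma ses_pushout A B N D E (f : {linear A -> B}) (g : {linear B -> N})
    (h : {linear A -> D}) (k : {linear D -> E}) : ses f g -> ses h k ->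
  exists (P : lmodType R) (f' : {linear D -> P}) (g' : {linear P -> N})
    (h' : {linear B -> P}) (k' : {linear P -> E}),
  [/\ ses f' g', ses h' k' & forall x, f' (h x) = h' (f x)].
Proof.
move=> [injf ef sg] [injh eh sk].
have lu : linear (fun a => (f a, - h a)).
  by move=> a x y; congr (_, _); rewrite /= linearP // opprD -scalerN.
have [P [p [sp ep]]] := @coker_exists R A (B * D)%type (mk_lin lu).
have lb : linear (fun b : B => (b, 0 : D)).
  by move=> a x y; congr (_, _); rewrite /= scaler0 addr0.
have ld : linear (fun d : D => (0 : B, d)).
  by move=> a x y; congr (_, _); rewrite /= scaler0 addr0.
pose h' : {linear B -> P} := p \o mk_lin lb.
pose f' : {linear D -> P} := p \o mk_lin ld.
have [|g' hg'] := @factor_surj R _ P N p (g \o fst) sp.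
  by move=> x /ep [a <-] /=; apply: exact_comp0.
have [|k' hk'] := @factor_surj R _ P E p (k \o snd) sp.
  by move=> x /ep [a <-] /=; rewrite linearN (exact_comp0 a eh) oppr0.
exists P, f', g', h', k'; split; first split.
- apply: inj_ker0 => d /ep [a [/= fa <-]].
  have -> : a = 0 by apply: injf; rewrite linear0.
  by rewrite linear0 oppr0.
- move=> y; case: (sp y) => -[b d] <-; rewrite hg' /=; split.
    move=> /ef [a fa]; exists (d + h a); rewrite /f' /=.
    apply/eqP; rewrite -subr_eq0 -linearB; apply/eqP/ep; exists (- a).
    by rewrite /= !linearN fa opprK; congr (_, _);
      rewrite /= ?sub0r // addrC addKr.
  move=> [d' /= e]; rewrite -[g b]/((g \o fst) (b, d)) -hg' -e.
  by rewrite hg' /= linear0.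
- by move=> n; case: (sg n) => b <-; exists (p (b, 0)); rewrite hg'.
- split.
  + apply: inj_ker0 => b /ep [a [/= <- ha]].
    have -> : a = 0 by apply: injh; rewrite linear0; apply: oppr_inj;
      rewrite ha oppr0.
    by rewrite linear0.
  + move=> y; case: (sp y) => -[b d] <-; rewrite hk' /=; split.
      move=> /eh [a fa]; exists (b + f a); rewrite /h' /=.
      apply/eqP; rewrite -subr_eq0 -linearB; apply/eqP/ep; exists a.
      by rewrite /= fa; congr (_, _); rewrite /= ?sub0r // addrC addKr.
    move=> [b' /= e]; rewrite -[k d]/((k \o snd) (b, d)) -hk' -e.
    by rewrite hk' /= linear0.
  + by move=> n; case: (sk n) => b <-; exists (p (0, b)); rewrite hk'.
- move=> a; rewrite /f' /h' /=.
  apply/eqP; rewrite -subr_eq0 -linearB; apply/eqP/ep; exists (- a).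
  by rewrite /= !linearN opprK; congr (_, _); rewrite /= ?sub0r ?subr0.
Qed.

Lemma ses_split_retract A B N (f : {linear A -> B}) (g : {linear B -> N}) :
  injective_mod A -> ses f g -> exists r :
    {linear B -> A}, forall x, r (f x) = x.
Proof. by move=> injA [injf _ _]; apply: (injA A B f idfun). Qed.

End Diagrams.

(** * Duality for tensor products *)

Section DualExactness.
Variables U V W : zmodType.

(** One direction is the injectivity of [QZ]. For the other, a character that is nonzero at [u - u']
    cannot factor through [f] when [f u = f u']. *)
Lemma dual_injective (f : {additive U -> V}) : injective f <->
  forall x : {additive U -> QZ}, exists y : {additive V -> QZ},
  forall u, y (f u) = x u.
Proof.
split => [inj x|h u u' e]; first exact: QZ_injective.
apply/eqP; rewrite -subr_eq0; apply/negP => /negP /QZ_cogenerator [x].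
have [y hy] := h x.
by rewrite raddfB -!hy e subrr eqxx.
Qed.

Lemma dual_exact (f : {additive U -> V}) (g : {additive V -> W}) :
  exact_at f g <->
  (forall u, g (f u) = 0) /\
  forall x : {additive V -> QZ}, (forall u, x (f u) = 0) ->
  exists y : {additive W -> QZ}, forall v, y (g v) = x v.
Proof.
split => [e|[gf h]].
  split => [u|x x0]; first by apply/e; exists u.
  (* As [x] vanishes on the image of [f], which is the kernel of [g], it descends to the image of
     [g]. The descended map is given by its graph and then extended to [W]. *)
  have [r [[h0 hB h1] hr]] : exists r : set (W * QZ),
      partial_hom r /\ forall v, r (g v, x v).
    exists [set p | exists v, (g v, x v) = p]; split; last by move=> v;
      exists v.
    split; first by exists 0; rewrite !raddf0.
      by move=> p q [v <-] [w <-]; exists (v - w); rewrite !raddfB.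
    by move=> q [v [/e [u <-] <-]].
  have [|y hy] := @partial_hom_extends _ r; first by split.
  by exists y => v; rewrite (hy _ (hr v)).
move=> v; split=> [gv|[u <-] //].
apply: contrapT => nv.
pose K : {pred V} := fun w => `[< exists u, f u = w >].
have Kc : zmod_closed K.
  split=> [|a b /asboolP [x <-] /asboolP [y <-]]; apply/asboolP.
    by exists 0; rewrite raddf0.
  by exists (x - y); rewrite raddfB.
pose Ka : zmodClosed V := HB.pack K (GRing.isZmodClosed.Build _ K Kc).
(* If [v] is not in the image of [f], a character of the quotient by that image detects it; yet this
   character factors through [g], which kills [v]. *)
have [|x hx] := @QZ_cogenerator (Quotient.quot Ka) (\pi_(Quotient.quot Ka) v).
  apply/negP; rewrite -(raddf0 (\pi_(Quotient.quot Ka)))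
    -Quotient.idealrBE subr0.
  by move=> /asboolP.
have [|y hy] := h (x \o \pi_(Quotient.quot Ka)).
  move=> u /=; rewrite -[RHS](raddf0 x); congr (x _); apply/eqP.
  rewrite -(raddf0 (\pi_(Quotient.quot Ka))) -Quotient.idealrBE subr0.
  by apply/asboolP; exists u.
by move: hx => /=; rewrite -[x _]hy gv raddf0 eqxx.
Qed.

End DualExactness.

Section Balanced.
Variables (R : pzRingType) (E : lmodType R^c) (M : lmodType R).

Definition bal_pred : {pred E -> M -> QZ} := fun b => `[< balanced b >].

Lemma bal_pred_closed : zmod_closed bal_pred.
Proof.
split=> [|f g /asboolP [f1 f2 f3] /asboolP [g1 g2 g3]]; apply/asboolP.
  by split=> // *; apply/esym/addr0.
split=> *; rewrite !fctE.
- by rewrite f1 g1 opprD addrACA.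
- by rewrite f2 g2 opprD addrACA.
- by rewrite f3 g3.
Qed.

HB.instance Definition _ :=
  GRing.isZmodClosed.Build (E -> M -> QZ) bal_pred bal_pred_closed.

(* The character group of [tens E M], as a group of balanced maps. *)
Record bal : Type := Bal {
  bal_fun :> E -> M -> QZ;
  bal_funP : bal_fun \in bal_pred }.

HB.instance Definition _ := [isSub for bal_fun].
HB.instance Definition _ := [Choice of bal by <:].
HB.instance Definition _ := [SubChoice_isSubZmodule of bal by <:].

Lemma balP (b : bal) : balanced b.
Proof. exact/asboolP/bal_funP. Qed.

Lemma mk_bal_subproof (b : E -> M -> QZ) : balanced b -> b \in bal_pred.
Proof. by move/asboolP. Qed.

Definition mk_bal b (hb : balanced b) : bal := Bal (mk_bal_subproof hb).

Lemma bal_ext (b c : bal) : (forall x y, b x y = c x y) -> b = c.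
Proof. by move=> h; apply: val_inj; apply: funext => x; apply: funext => y. Qed.

Lemma balDl (b : bal) x x' y : b (x + x') y = b x y + b x' y.
Proof. by case: (balP b). Qed.

Lemma balDr (b : bal) x y y' : b x (y + y') = b x y + b x y'.
Proof. by case: (balP b). Qed.

Lemma balZ (b : bal) x (r : R) y : b ((r : R^c) *: x) y = b x (r *: y).
Proof. by case: (balP b). Qed.

Lemma bal0l (b : bal) y : b 0 y = 0.
Proof. by apply: (@addrI _ (b 0 y)); rewrite -balDl !addr0. Qed.

Lemma bal0r (b : bal) x : b x 0 = 0.
Proof. by apply: (@addrI _ (b x 0)); rewrite -balDr !addr0. Qed.

Lemma balNl (b : bal) x y : b (- x) y = - b x y.
Proof. by apply: (@addrI _ (b x y)); rewrite -balDl !subrr bal0l. Qed.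

Lemma balNr (b : bal) x y : b x (- y) = - b x y.
Proof. by apply: (@addrI _ (b x y)); rewrite -balDr !subrr bal0r. Qed.

Definition bal_lift (b : bal) : {additive tens E M -> QZ} :=
  mk_add (tens_lift_zmod_morphism (balP b)).

Lemma bal_liftE (b : bal) x y : bal_lift b (tensp x y) = b x y.
Proof. exact/tens_liftE/balP. Qed.

Lemma bal_of_subproof (f : {additive tens E M -> QZ}) :
  balanced (fun x y => f (tensp x y)).
Proof.
by have [h1 h2 h3] := tensp_balanced E M; split=> *;
  rewrite ?h1 ?h2 ?h3 ?raddfD.
Qed.

Definition bal_of f : bal := mk_bal (@bal_of_subproof f).

(** Representatives are integral combinations of pairs, so pure tensors generate. *)
Lemma tens_ext (V : zmodType) (f g : {additive tens E M -> V}) :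
  (forall x y, f (tensp x y) = g (tensp x y)) -> f =1 g.
Proof.
move=> h t; rewrite -[t](@reprK _ (Quotient.quot (@tens_sub R E M))).
rewrite -[repr _]freeg_sumE !raddf_sum; apply: eq_bigr => -[x y] _.
rewrite -[coeff _ _]intz -freegU_mulz !raddfMz; congr (_ *~ _); apply: h.
Qed.

End Balanced.

Section BalancedMaps.
Variables (R : pzRingType) (E E' : lmodType R^c) (M M' : lmodType R).
Variables (f : {linear E' -> E}) (g : {linear M' -> M}).

Lemma bal_map_subproof (b : bal E M) : balanced (fun x y => b (f x) (g y)).
Proof.
split=> *; rewrite ?linearD ?balDl ?balDr //.
by rewrite !linearZ /= balZ.
Qed.

Definition bal_map (b : bal E M) : bal E' M' := mk_bal (bal_map_subproof b).

Lemma bal_map_is_additive : zmod_morphism bal_map.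
Proof. by move=> b c; apply: bal_ext. Qed.

HB.instance Definition _ :=
  GRing.isZmodMorphism.Build _ _ bal_map bal_map_is_additive.

End BalancedMaps.

Arguments bal_map {R E E' M M'} f g b.
Notation bal_l f := (bal_map f idfun).
Notation bal_r g := (bal_map idfun g).

Section TensorDuality.
Variables (R : pzRingType) (E1 E2 E3 : lmodType R^c) (M1 M2 M3 : lmodType R).
Variables (f : {linear E1 -> E2}) (g : {linear M1 -> M2}).

(** Balanced maps are the characters of the tensor product, so this is [dual_injective] read through
    [bal_lift] and [bal_of]. *)
Lemma tens_map_inj : injective (tens_map f g) <-> surj (bal_map f g).
Proof.
rewrite dual_injective; split => h b.
  have [y hy] := h (bal_lift b); exists (bal_of y); apply: bal_ext => u v /=.
  by rewrite -tens_mapE hy bal_liftE.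
have [y hy] := h (bal_of b); exists (bal_lift y) => u.
apply: (tens_ext (f := bal_lift y \o tens_map f g) (g := b)) => u' v' /=.
by rewrite tens_mapE; have := bal_liftE y; rewrite /= => ->;
  rewrite -[y _ _]/(bal_map f g y u' v') hy.
Qed.

Variables (f' : {linear E2 -> E3}) (g' : {linear M2 -> M3}).

Lemma tens_map_exact : exact_at (tens_map f g) (tens_map f' g') <->
  exact_at (bal_map f' g') (bal_map f g).
Proof.
rewrite dual_exact; split => [[fg h] b|h].
  split => [b0|[c <-]].
    have [|y hy] := h (bal_lift b).
      move=> u; apply: (tens_ext (f := bal_lift b \o tens_map f g)
        (g := @GRing.null_fun _ _)) => u' v'.
      rewrite /= tens_mapE; have := bal_liftE b; rewrite /= => ->.
      by rewrite -[LHS]/(bal_map f g b u' v') b0.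
    exists (bal_of y); apply: bal_ext => u v /=.
    by rewrite -tens_mapE hy bal_liftE.
  apply: bal_ext => u v /=; rewrite -bal_liftE -!tens_mapE fg raddf0 //.
split => [u|b b0].
  apply: (tens_ext (f := tens_map f' g' \o tens_map f g)
        (g := @GRing.null_fun _ _)) => u' v' /=.
  apply: contrapT => /eqP /QZ_cogenerator [x] /negP; apply; apply/eqP.
  rewrite !tens_mapE -[LHS]/(bal_map f g (bal_map f' g' (bal_of x)) u' v').
  by rewrite (exact_comp0 _ h).
have [|c hc] := (h (bal_of b)).1.
  by apply: bal_ext => x y; move: (b0 (tensp x y)); rewrite /= tens_mapE.
exists (bal_lift c) => v.
apply: (tens_ext (f := bal_lift c \o tens_map f' g') (g := b)) => x y /=.
rewrite tens_mapE; have := bal_liftE c; rewrite /= => ->.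
by rewrite -[RHS]/(bal_of b x y) -hc.
Qed.

End TensorDuality.

(** * Direct sums and free modules *)

Section DirectSum.
Variables (R : pzRingType) (Z : lmodType R) (S : choiceType).

Definition fin_supp (f : S -> Z) : Prop :=
  exists l : seq S, forall s, f s != 0 -> s \in l.

Lemma fin_supp0 : fin_supp 0.
Proof. by exists [::] => s; rewrite eqxx. Qed.

Lemma fin_suppD a f g : fin_supp f -> fin_supp g -> fin_supp (a *: f + g).
Proof.
move=> [l hl] [m hm]; exists (l ++ m) => s; rewrite mem_cat => fg.
apply/orP; case: (eqVneq (f s) 0) fg => [fs|/hl]; last by left.
rewrite -[(a *: f + g) s]/(a *: f s + g s) fs scaler0 add0r => /hm; by right.
Qed.

Definition dsum : lmodType R := submodule (mk_submod fin_supp0 fin_suppD).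

Lemma dsumP (f : dsum) :
  exists l : seq S, uniq l /\ forall s, submodule_val f s != 0 -> s \in l.
Proof.
have /mem_submod [l hl] := submoduleP f.
by exists (undup l); split; [exact: undup_uniq | move=> s /hl;
  rewrite mem_undup].
Qed.

Lemma delta_subproof s z : fin_supp (fun t => if t == s then z else 0).
Proof. by exists [:: s] => t; rewrite inE; case: (t == s); rewrite ?eqxx. Qed.

Definition delta_fun s z : dsum :=
  Submodule ((mem_submod fin_supp0 fin_suppD _).2 (delta_subproof s z)).

Lemma dsum_eq (f g : dsum) :
  (forall s, submodule_val f s = submodule_val g s) -> f = g.
Proof. by move=> h; apply: val_inj; apply: funext. Qed.

Lemma delta_linear s : linear (delta_fun s).
Proof.
move=> a x y; apply: dsum_eq => t /=.
rewrite -[RHS]/(a *: (if t == s then x else 0) + (if t == s then y else 0)).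
by case: eqP; rewrite ?scaler0 ?addr0.
Qed.

Definition delta s : {linear Z -> dsum} := mk_lin (delta_linear s).

Section Lift.
Variables (V : zmodType) (h : S -> Z -> V).
Hypothesis hD : forall s, zmod_morphism (h s).

Lemma dsum_h0 s : h s 0 = 0.
Proof. by have := hD s 0 0; rewrite !subrr. Qed.

Definition dsum_lift (f : dsum) : V :=
  \sum_(s <- projT1 (cid (dsumP f))) h s (submodule_val f s).

(** [dsum_lift] sums over a list picked by choice. Terms outside the support vanish, so every
    duplicate-free list covering the support gives the same value; additivity relies on a common
    list for two elements. *)
Lemma dsum_liftE (f : dsum) (l : seq S) : uniq l ->
  (forall s, submodule_val f s != 0 -> s \in l) ->
  dsum_lift f = \sum_(s <- l) h s (submodule_val f s).
Proof.
move=> ul hl; rewrite /dsum_lift; case: cid => m /= [um hm].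
have key (k : seq S) : \sum_(s <- k) h s (submodule_val f s) =
    \sum_(s <- [seq s <- k | submodule_val f s != 0]) h s (submodule_val f s).
  rewrite big_filter [LHS](bigID (fun s => submodule_val f s != 0)) /=.
  rewrite [X in _ + X]big1 ?addr0 // => s; rewrite negbK => /eqP ->.
  exact: dsum_h0.
rewrite key [RHS]key; apply: perm_big; apply: uniq_perm;
  rewrite ?filter_uniq //.
by move=> s; rewrite !mem_filter; case: eqP => //= /eqP fs;
  rewrite (hl _ fs) (hm _ fs).
Qed.

Lemma dsum_lift_delta s z : dsum_lift (delta s z) = h s z.
Proof.
rewrite (@dsum_liftE _ [:: s]) //; first by rewrite big_seq1 /= eqxx.
by move=> t /=; rewrite inE; case: (t == s); rewrite ?eqxx.
Qed.

Lemma dsum_lift_is_additive : zmod_morphism dsum_lift.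
Proof.
move=> f g; have [l [ul hl]] := dsumP f; have [m [um hm]] := dsumP g.
pose k := undup (l ++ m).
have hk s : submodule_val f s != 0 \/ submodule_val g s != 0 -> s \in k.
  by rewrite mem_undup mem_cat => -[/hl|/hm] ->; rewrite ?orbT.
have uk : uniq k by apply: undup_uniq.
rewrite (dsum_liftE (f := f) uk) => [|s hf]; last by apply: hk; left.
rewrite (dsum_liftE (f := g) uk) => [|s hg]; last by apply: hk; right.
rewrite (dsum_liftE (f := f - g) uk) => [|s /= fg].
  by rewrite -sumrB; apply: eq_bigr => s _; rewrite -hD.
apply: hk; case: (eqVneq (submodule_val f s) 0) => [fs|]; last by left.
right; move: fg.
by rewrite -[X in X != 0]/(submodule_val f s - submodule_val g s) fs sub0r
  oppr_eq0.
Qed.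

End Lift.

Lemma dsum_decomp (f : dsum) :
  exists l : seq S, f = \sum_(s <- l) delta s (submodule_val f s).
Proof.
have [l [ul hl]] := dsumP f; exists l; apply: dsum_eq => t.
have -> g : submodule_val (\sum_(s <- l) g s : dsum) t =
    \sum_(s <- l) submodule_val (g s) t.
  by elim: l {ul hl} => [|s l IH]; rewrite ?big_nil // !big_cons -IH.
case: (boolP (t \in l)) => tl.
  rewrite (bigD1_seq t) //= eqxx big1 ?addr0 // => s.
  by rewrite eq_sym => /negPf ->.
rewrite big1_seq => [|s /= sl].
  by apply/eqP/negPn; apply: contra tl; apply: hl.
by case: eqP tl => // ->; rewrite sl.
Qed.

Lemma dsum_ext (V : zmodType) (f g : {additive dsum -> V}) :
  (forall s z, f (delta s z) = g (delta s z)) -> f =1 g.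
Proof.
move=> h x; have [l ->] := dsum_decomp x; rewrite !raddf_sum.
by apply: eq_bigr => s _; apply: h.
Qed.

Lemma dsum_lin_exists (N : lmodType R) (h : S -> {linear Z -> N}) :
  exists f : {linear dsum -> N}, forall s z, f (delta s z) = h s z.
Proof.
have hD s : zmod_morphism (h s) by move=> x y; rewrite linearB.
have lf : linear (dsum_lift (fun s => h s)).
  move=> a x y; have [l hl] := dsumP x.
  have add := dsum_lift_is_additive hD.
  pose fa : {additive dsum -> N} := mk_add add.
  rewrite -[LHS]/(fa (a *: x + y)) raddfD; congr (_ + _).
  rewrite -[RHS]/(a *: fa x).
  have [m ->] := dsum_decomp x; rewrite scaler_sumr !(raddf_sum fa) scaler_sumr.
  apply: eq_bigr => s _; rewrite -linearZ -[fa _]/(dsum_lift _ (delta s _)).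
  rewrite -[fa _]/(dsum_lift _ (delta s _)).
  by rewrite !(dsum_lift_delta hD) linearZ.
by exists (mk_lin lf) => s z /=; apply: (dsum_lift_delta hD).
Qed.

Lemma dsum_add_exists (V : zmodType) (h : S -> {additive Z -> V}) :
  exists f : {additive dsum -> V}, forall s z, f (delta s z) = h s z.
Proof.
have hD s : zmod_morphism (h s) by move=> x y; rewrite raddfB.
exists (mk_add (dsum_lift_is_additive hD)) => s z /=.
exact: (dsum_lift_delta hD).
Qed.

Lemma dsum_projective : projective Z -> projective dsum.
Proof.
move=> pZ A B p f sp.
have /choice [g hg] s : exists g :
  {linear Z -> A}, forall z, p (g z) = f (delta s z).
  exact: (pZ A B p (f \o delta s) sp).
have [g' hg'] := dsum_lin_exists g; exists g'.
apply: (dsum_ext (f := p \o g')) => s z /=.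
by rewrite -hg -hg'.
Qed.

End DirectSum.

Section BalancedDirectSum.

Lemma bal_dsum_ext_r (R : pzRingType) (E : lmodType R^c) (Z : lmodType R)
    (S : choiceType) (b c : bal E (dsum Z S)) :
  (forall s, bal_r (delta Z s) b = bal_r (delta Z s) c) -> b = c.
Proof.
move=> h; apply: bal_ext => x.
have bD (d : bal E (dsum Z S)) : zmod_morphism (d x).
  by move=> y y'; rewrite balDr balNr.
apply: (dsum_ext (f := mk_add (bD b)) (g := mk_add (bD c))) => s z /=.
exact: (congr1 (fun d => bal_fun d x z) (h s)).
Qed.

Lemma bal_dsum_ext_l (R : pzRingType) (Z : lmodType R^c) (M : lmodType R)
    (S : choiceType) (b c : bal (dsum Z S) M) :
  (forall s, bal_l (delta Z s) b = bal_l (delta Z s) c) -> b = c.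
Proof.
move=> h; apply: bal_ext => x y; move: x.
have bD (d : bal (dsum Z S) M) : zmod_morphism (d^~ y).
  by move=> x x'; rewrite balDl balNl.
apply: (dsum_ext (f := mk_add (bD b)) (g := mk_add (bD c))) => s z /=.
exact: (congr1 (fun d => bal_fun d z y) (h s)).
Qed.

(** The dual turns a direct sum into a product: a balanced map may be prescribed freely on each
    summand. *)
Lemma bal_dsum_r (R : pzRingType) (E : lmodType R^c) (Z : lmodType R)
    (S : choiceType) (h : S -> bal E Z) :
  exists b : bal E (dsum Z S), forall s, bal_r (delta Z s) b = h s.
Proof.
have hD x s : zmod_morphism (h s x) by move=> y y'; rewrite balDr balNr.
pose b x := dsum_lift (fun s => h s x).
have bB x : zmod_morphism (b x) := dsum_lift_is_additive (hD x).
have bD x y y' : b x (y + y') = b x y + b x y' := raddfD (mk_add (bB x)) y y'.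
have hb : balanced b.
  split => // [x x' y|x r y].
    have [l [ul hl]] := dsumP y.
    rewrite /b !(dsum_liftE (hD _) ul hl) -big_split.
    by apply: eq_bigr => s _; rewrite balDl.
  have [l [ul hl]] := dsumP y.
  rewrite /b !(@dsum_liftE _ _ _ _ _ (hD _) _ l) //.
    by apply: eq_bigr => s _; rewrite balZ.
  move=> s ys; apply: hl; apply: contra ys => /eqP ys.
  by rewrite -[X in X == 0]/(r *: submodule_val y s) ys scaler0.
exists (mk_bal hb) => s; apply: bal_ext => x z /=.
exact: (dsum_lift_delta (hD x)).
Qed.

Lemma bal_dsum_l (R : pzRingType) (Z : lmodType R^c) (M : lmodType R)
    (S : choiceType) (h : S -> bal Z M) :
  exists b : bal (dsum Z S) M, forall s, bal_l (delta Z s) b = h s.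
Proof.
have hD y s : zmod_morphism ((h s)^~ y) by move=> x x'; rewrite balDl balNl.
pose b x y := dsum_lift (fun s z => h s z y) x.
have bB y : zmod_morphism (b^~ y) := dsum_lift_is_additive (hD y).
have bD x x' y : b (x + x') y = b x y + b x' y := raddfD (mk_add (bB y)) x x'.
have hb : balanced b.
  split => // [x y y'|x r y].
    have [l [ul hl]] := dsumP x.
    rewrite /b !(dsum_liftE (hD _) ul hl) -big_split.
    by apply: eq_bigr => s _; rewrite balDr.
  have [l [ul hl]] := dsumP x.
  rewrite /b !(@dsum_liftE _ _ _ _ _ (hD _) _ l) //.
    by apply: eq_bigr => s _; rewrite -balZ.
  move=> s ys; apply: hl; apply: contra ys => /eqP ys.
  by rewrite -[X in X == 0]/((r : R^c) *: submodule_val x s) ys scaler0.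
exists (mk_bal hb) => s; apply: bal_ext => z y /=.
exact: (dsum_lift_delta (hD y)).
Qed.

End BalancedDirectSum.

(** * Flatness of free modules, and free covers *)

Section FlatCriterion.
Variable R : pzRingType.

Lemma flat_leftP (M : lmodType R) : flat_left M <->
  forall (A B : lmodType R^c) (f : {linear A -> B}), injective f ->
  surj (bal_l f : bal B M -> bal A M).
Proof. by split => h A B f /h /tens_map_inj. Qed.

Lemma flat_rightP (E : lmodType R^c) : flat_right E <->
  forall (A B : lmodType R) (f : {linear A -> B}), injective f ->
  surj (bal_r f : bal E B -> bal E A).
Proof. by split => h A B f /h /tens_map_inj. Qed.

Lemma flat_left_dsum (Z : lmodType R) (S : choiceType) :
  flat_left Z -> flat_left (dsum Z S).
Proof.
move=> /flat_leftP h; apply/flat_leftP => A B f /h sf b.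
have /choice [c hc] s : exists c : bal B Z, bal_l f c = bal_r (delta Z s) b.
  exact: sf.
have [d hd] := bal_dsum_r c; exists d; apply: bal_dsum_ext_r => s.
by rewrite -hc -hd; apply: bal_ext.
Qed.

Lemma flat_right_dsum (Z : lmodType R^c) (S : choiceType) :
  flat_right Z -> flat_right (dsum Z S).
Proof.
move=> /flat_rightP h; apply/flat_rightP => A B f /h sf b.
have /choice [c hc] s : exists c : bal Z B, bal_r f c = bal_l (delta Z s) b.
  exact: sf.
have [d hd] := bal_dsum_l c; exists d; apply: bal_dsum_ext_l => s.
by rewrite -hc -hd; apply: bal_ext.
Qed.

(** A balanced map [b] on [A] and [R^o] is determined by the character [b x 1] of [A], so extending
    it along [f] is the injectivity of [QZ]. *)
Lemma flat_left_regular : flat_left (R^o : lmodType R).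
Proof.
apply/flat_leftP => A B f inj b.
have bB : zmod_morphism (fun x => b x 1) by move=> x x'; rewrite balDl balNl.
have [g hg] := @QZ_injective A B f (mk_add bB) inj.
have hb : balanced (fun (x : B) (r : R^o) => g ((r : R^c) *: x)).
  split=> [x x' y|x y y'|x r y]; first by rewrite scalerDr raddfD.
    by rewrite (@scalerDl R^c) raddfD.
  by rewrite scalerA.
exists (mk_bal hb); apply: bal_ext => x r /=.
rewrite -[_ *: f x]linearZ hg /= balZ; congr (b x _).
exact: mulr1.
Qed.

Lemma flat_right_regular : flat_right (R^c^o : lmodType R^c).
Proof.
apply/flat_rightP => A B f inj b.
have bB : zmod_morphism (fun x => b 1 x) by move=> x x'; rewrite balDr balNr.
have [g hg] := @QZ_injective A B f (mk_add bB) inj.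
have hb : balanced (fun (r : R^c^o) (x : B) => g ((r : R) *: x)).
  split=> [y y' x|y x x'|y r x]; last by rewrite scalerA.
    by rewrite (@scalerDl R) raddfD.
  by rewrite scalerDr raddfD.
exists (mk_bal hb); apply: bal_ext => r x /=.
rewrite -[(r : R) *: f x]linearZ hg /= -balZ; congr (b _ x).
exact: (mulr1 (r : R^c)).
Qed.

Lemma projective_regular : projective (R^o : lmodType R).
Proof.
move=> A B p f sp; have [a ha] := sp (f 1).
have lg : linear (fun r : R^o => (r : R) *: a).
  by move=> r x y; rewrite scalerDl scalerA.
exists (mk_lin lg) => r /=; rewrite linearZ ha -linearZ; congr (f _).
exact: mulr1.
Qed.

Lemma dsum_cover (M : lmodType R) :
  exists p : {linear dsum R^o M -> M}, surj p.
Proof.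
have lh (m : M) : linear (fun r : R^o => (r : R) *: m).
  by move=> r x y; rewrite scalerDl scalerA.
have [p hp] := dsum_lin_exists (fun m => mk_lin (lh m)).
by exists p => m; exists (delta R^o m 1); rewrite hp /= scale1r.
Qed.

End FlatCriterion.

(** * Enough injectives *)

Section Cofree.
Variable R : pzRingType.

(* Hom_Z(R, Q/Z) as a left module, (r f)(x) = f(x r). *)
Definition cofree : Type := charmod (R^o : lmodType R).
HB.instance Definition _ := GRing.Zmodule.on cofree.

Lemma cofree_scale_subproof (r : R) (f : cofree) :
  (fun x : R^o => charmod_fun f ((x : R) * r)) \in char_pred (M := R^o).
Proof.
by apply/asboolP => x y; rewrite mulrBl; have /asboolP := charmodP f; apply.
Qed.

Definition cofree_scale r f : cofree := Charmod (cofree_scale_subproof r f).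

Lemma cofree_scaleA a b f :
  cofree_scale a (cofree_scale b f) = cofree_scale (a * b) f.
Proof. by apply: charmod_ext => x /=; rewrite mulrA. Qed.

Lemma cofree_scale1 : left_id 1 cofree_scale.
Proof. by move=> f; apply: charmod_ext => x /=; rewrite mulr1. Qed.

Lemma cofree_scaleDr : right_distributive cofree_scale +%R.
Proof. by move=> a f g; apply: charmod_ext. Qed.

Lemma charmodD (M : lmodType R) (f : charmod M) x y : f (x + y) = f x + f y.
Proof.
have /asboolP h := charmodP f; pose fa := mk_add h.
exact: (raddfD fa).
Qed.

Lemma cofree_scaleDl f : {morph cofree_scale^~ f : a b / a + b}.
Proof.
by move=> a b; apply: charmod_ext => x /=; rewrite mulrDr charmodD.
Qed.

HB.instance Definition _ := GRing.Zmodule_isLmodule.Build R cofree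
  cofree_scaleA cofree_scale1 cofree_scaleDr cofree_scaleDl.

(** The adjunction Hom_Z(M, Q/Z) = Hom_R(M, Hom_Z(R, Q/Z)), which turns injectivity of [QZ] over the
    integers into injectivity of [cofree] over [R]. *)
Lemma cofree_adjoint (M : lmodType R) (f : {additive M -> QZ}) :
  exists g : {linear M -> cofree}, forall x r,
    charmod_fun (g x) r = f ((r : R) *: x).
Proof.
have h x : (fun r : R^o => f ((r : R) *: x)) \in char_pred (M := R^o).
  by apply/asboolP => r s; rewrite scalerBl raddfB.
have l : linear (fun x => Charmod (h x) : cofree).
  move=> a x y; apply: charmod_ext => r /=.
  by rewrite scalerDr raddfD scalerA.
by exists (mk_lin l).
Qed.

Lemma cofree_injective : injective_mod cofree.
Proof.
move=> A B i f inj.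
have l : zmod_morphism (fun x => charmod_fun (f x) 1) by move=> x y;
  rewrite linearB.
have [g hg] := @QZ_injective A B i (mk_add l) inj.
have [h hh] := cofree_adjoint g; exists h => x; apply: charmod_ext => r.
rewrite hh -linearZ hg /= linearZ /=; congr (charmod_fun (f x) _).
exact: mul1r.
Qed.

Lemma injective_mod_prod (I : Type) (M : lmodType R) :
  injective_mod M -> injective_mod (I -> M).
Proof.
move=> injM A B i f inj.
have /choice [g hg] s : exists g : {linear B -> M}, forall x, g (i x) = f x s.
  have l : linear (fun x => f x s) by move=> a x y; rewrite linearP.
  exact: (injM A B i (mk_lin l) inj).
have l : linear (fun x s => g s x).
  by move=> a x y; apply: funext => s; rewrite linearP.
by exists (mk_lin l) => x; apply: funext => s /=.
Qed.

Lemma enough_injectives (M : lmodType R) :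
  exists (J : lmodType R) (i : {linear M -> J}), injective_mod J /\ injective i.
Proof.
have /choice [g hg] (f : charmod M) :
    exists g : {linear M -> cofree}, forall x r,
      charmod_fun (g x) r = f ((r : R) *: x).
  have /asboolP h := charmodP f.
  exact: (cofree_adjoint (mk_add h)).
have l : linear (fun x f => g f x).
  by move=> a x y; apply: funext => s; rewrite linearP.
(* One copy of [cofree] for each character of [M]; the embedding is injective because characters
   separate points. *)
exists (charmod M -> cofree), (mk_lin l); split.
  exact/injective_mod_prod/cofree_injective.
apply: inj_ker0 => x /= gx.
apply: contrapT => /eqP /QZ_cogenerator [f] /negP; apply; apply/eqP.
have h : (f : M -> QZ) \in char_pred (M := M) by apply/asboolP => a b;
  rewrite raddfB.
have := congr1 (fun k : charmod M ->
  cofree => charmod_fun (k (Charmod h)) 1) gx.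
by rewrite hg /= scale1r.
Qed.

End Cofree.

Lemma add_inj0 (X Y : zmodType) (f : {additive X -> Y}) x :
  injective f -> f x = 0 -> x = 0.
Proof. by move=> inj e; apply: inj; rewrite e raddf0. Qed.

(** * Vanishing of Tor *)

Section Chase.
Variables U0 U1 U2 U3 V0 V1 V2 V3 W0 W1 W2 W3 : zmodType.
Variables (u0 : {additive U0 -> V0}) (u1 : {additive U1 -> V1})
  (u2 : {additive U2 -> V2}) (u3 : {additive U3 -> V3}).
Variables (v0 : {additive V0 -> W0}) (v1 : {additive V1 -> W1})
  (v2 : {additive V2 -> W2}).
Variables (dU0 : {additive U0 -> U1}) (dU1 : {additive U1 -> U2})
  (dU2 : {additive U2 -> U3}).
Variables (dV0 : {additive V0 -> V1}) (dV1 : {additive V1 -> V2})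
  (dV2 : {additive V2 -> V3}).
Variables (dW0 : {additive W0 -> W1}) (dW1 : {additive W1 -> W2}).
Hypothesis (cu0 : forall x, u1 (dU0 x) = dV0 (u0 x)).
Hypothesis (cu1 : forall x, u2 (dU1 x) = dV1 (u1 x)).
Hypothesis (cu2 : forall x, u3 (dU2 x) = dV2 (u2 x)).
Hypothesis (cv0 : forall x, v1 (dV0 x) = dW0 (v0 x)).
Hypothesis (cv1 : forall x, v2 (dV1 x) = dW1 (v1 x)).
Hypothesis (ddU : forall x, dU2 (dU1 x) = 0).
Hypothesis (ddV0 : forall x, dV1 (dV0 x) = 0).
Hypothesis (ddV1 : forall x, dV2 (dV1 x) = 0).
Hypothesis (ddW : forall x, dW1 (dW0 x) = 0).
Hypothesis (row1 : ses u1 v1).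
Hypothesis (row2 : ses u2 v2).

(** The four chases are fragments of the long exact sequence of a short exact sequence of complexes
    U -> V -> W. The outer rows enter through [surj v0] or [injective u3], since in an augmented
    complex row 0 comes from a module that need not be flat. *)
Lemma chase_mid : surj v0 ->
  exact_at dU0 dU1 -> exact_at dW0 dW1 -> exact_at dV0 dV1.
Proof.
have [_ e1 _] := row1; have [i2 _ _] := row2.
move=> sv0 eU eW y; split=> [dy|[x <-]]; last exact: ddV0.
have /eW [w hw] : dW1 (v1 y) = 0 by rewrite -cv1 dy raddf0.
have [z hz] := sv0 w.
have /e1 [x hx] : v1 (y - dV0 z) = 0 by rewrite raddfB cv0 hz hw subrr.
have /eU [t ht] : dU1 x = 0.
  by apply: (add_inj0 i2); rewrite cu1 hx raddfB dy ddV0 subrr.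
exists (z + u0 t).
by rewrite raddfD -cu0 ht hx addrC subrK.
Qed.

Lemma chase_right : injective u3 ->
  exact_at dV0 dV1 -> exact_at dU1 dU2 -> exact_at dW0 dW1.
Proof.
have [_ e1 s1] := row1; have [_ e2 _] := row2.
move=> i3 eV eU y; split=> [dy|[x <-]]; last exact: ddW.
have [z hz] := s1 y.
have /e2 [x hx] : v2 (dV1 z) = 0 by rewrite cv1 hz.
have /eU [t ht] : dU2 x = 0 by apply: (add_inj0 i3); rewrite cu2 hx ddV1.
have /eV [r hr] : dV1 (z - u1 t) = 0 by rewrite raddfB -cu1 ht hx subrr.
exists (v0 r); rewrite -cv0 hr raddfB hz.
by rewrite (exact_comp0 t e1) subr0.
Qed.

Lemma chase_left : surj v0 ->
  exact_at dW0 dW1 -> exact_at dV1 dV2 -> exact_at dU1 dU2.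
Proof.
have [_ e1 _] := row1; have [i2 e2 _] := row2.
move=> sv0 eW eV y; split=> [dy|[x <-]]; last exact: ddU.
have /eV [z hz] : dV2 (u2 y) = 0 by rewrite -cu2 dy raddf0.
have /eW [w hw] : dW1 (v1 z) = 0 by rewrite -cv1 hz (exact_comp0 y e2).
have [t ht] := sv0 w.
have /e1 [x hx] : v1 (z - dV0 t) = 0 by rewrite raddfB cv0 ht hw subrr.
by exists x; apply: i2; rewrite cu1 hx raddfB ddV0 subr0.
Qed.

(** The end of the long exact sequence, at the augmentation: vanishing of Tor_1 of the cokernel will
    make [v0] surjective. *)
Lemma chase_surj : injective u3 -> injective dW0 ->
  exact_at dV0 dV1 -> exact_at dU1 dU2 -> surj v0.
Proof.
have [_ e1 s1] := row1; have [_ e2 _] := row2.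
move=> i3 iW eV eU w; have [z hz] := s1 (dW0 w).
have /e2 [x hx] : v2 (dV1 z) = 0 by rewrite cv1 hz.
have /eU [t ht] : dU2 x = 0 by apply: (add_inj0 i3); rewrite cu2 hx ddV1.
have /eV [r hr] : dV1 (z - u1 t) = 0 by rewrite raddfB -cu1 ht hx subrr.
exists r; apply: iW; rewrite -cv0 hr raddfB hz.
by rewrite (exact_comp0 t e1) subr0.
Qed.

End Chase.

Section BalExact.
Variable R : pzRingType.

(** Right exactness of the tensor product in dual form: a balanced map that kills the image of [f]
    is carried to [N] along a set-theoretic section of [g]. *)
Lemma bal_r_exact (E : lmodType R^c) (A B N : lmodType R)
    (f : {linear A -> B}) (g : {linear B -> N}) : exact_at f g -> surj g ->
  exact_at (bal_r g : bal E N -> bal E B) (bal_r f : bal E B -> bal E A).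
Proof.
move=> e sg b; split => [b0|[c <-]]; last first.
  by apply: bal_ext => x y /=; rewrite (exact_comp0 y e) bal0r.
have hb x y : b x (f y) = 0 by exact: (congr1 (fun d => bal_fun d x y) b0).
have [s hs] := choice sg.
have key x y y' : g y = g y' -> b x y = b x y'.
  move=> h; have /e [a ha] : g (y - y') = 0 by rewrite linearB h subrr.
  by rewrite -[y](subrK y') -ha balDr hb add0r.
have hc : balanced (fun x y => b x (s y)).
  split=> [x x' y|x y y'|x r y]; first exact: balDl.
    by rewrite -balDr; apply: key; rewrite hs linearD !hs.
  by rewrite balZ; apply: key; rewrite linearZ /= !hs.
exists (mk_bal hc); apply: bal_ext => x y /=.
by apply: key; rewrite hs.
Qed.

Lemma bal_r_inj (E : lmodType R^c) (B N : lmodType R) (g : {linear B -> N}) :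
  surj g -> injective (bal_r g : bal E N -> bal E B).
Proof.
move=> sg b c h; apply: bal_ext => x y; have [z <-] := sg y.
exact: (congr1 (fun d => bal_fun d x z) h).
Qed.

Lemma bal_l_exact (M : lmodType R) (A B N : lmodType R^c)
    (f : {linear A -> B}) (g : {linear B -> N}) : exact_at f g -> surj g ->
  exact_at (bal_l g : bal N M -> bal B M) (bal_l f : bal B M -> bal A M).
Proof.
move=> e sg b; split => [b0|[c <-]]; last first.
  by apply: bal_ext => x y /=; rewrite (exact_comp0 x e) bal0l.
have hb x y : b (f x) y = 0 by exact: (congr1 (fun d => bal_fun d x y) b0).
have [s hs] := choice sg.
have key x x' y : g x = g x' -> b x y = b x' y.
  move=> h; have /e [a ha] : g (x - x') = 0 by rewrite linearB h subrr.
  by rewrite -[x](subrK x') -ha balDl hb add0r.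
have hc : balanced (fun x y => b (s x) y).
  split=> [x x' y|x y y'|x r y].
  - by rewrite -balDl; apply: key; rewrite hs linearD !hs.
  - exact: balDr.
  - by rewrite -balZ; apply: key; rewrite linearZ /= !hs.
exists (mk_bal hc); apply: bal_ext => x y /=.
by apply: key; rewrite hs.
Qed.

Lemma bal_l_inj (M : lmodType R) (B N : lmodType R^c) (g : {linear B -> N}) :
  surj g -> injective (bal_l g : bal N M -> bal B M).
Proof.
move=> sg b c h; apply: bal_ext => x y; have [z <-] := sg x.
exact: (congr1 (fun d => bal_fun d z y) h).
Qed.

Lemma bal_r_ses (E : lmodType R^c) (A B N : lmodType R)
    (f : {linear A -> B}) (g : {linear B -> N}) : flat_right E -> ses f g ->
  ses (bal_r g : bal E N -> bal E B) (bal_r f : bal E B -> bal E A).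
Proof.
move=> /flat_rightP fl [inj e sg]; split.
- exact: bal_r_inj.
- exact: bal_r_exact.
- exact: fl.
Qed.

Lemma bal_l_ses (M : lmodType R) (A B N : lmodType R^c)
    (f : {linear A -> B}) (g : {linear B -> N}) : flat_left M -> ses f g ->
  ses (bal_l g : bal N M -> bal B M) (bal_l f : bal B M -> bal A M).
Proof.
move=> /flat_leftP fl [inj e sg]; split.
- exact: bal_l_inj.
- exact: bal_l_exact.
- exact: fl.
Qed.

(* A flat module is acyclic also when the exact sequence is not short: factor
   the second map through its image. *)
Lemma bal_l_flat_exact (M : lmodType R) (A B N : lmodType R^c)
    (f : {linear A -> B}) (g : {linear B -> N}) : flat_left M -> exact_at f g ->
  exact_at (bal_l g : bal N M -> bal B M) (bal_l f : bal B M -> bal A M).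
Proof.
move=> /flat_leftP fl e b; split=> [b0|[c <-]]; last first.
  by apply: bal_ext => x y /=; rewrite (exact_comp0 x e) bal0l.
have [I [p [i [sp inj h]]]] := image_exists g.
have ep : exact_at f p.
  move=> y; rewrite -e -h; split=> [->|]; first by rewrite linear0.
  by move=> iy; apply: inj; rewrite iy linear0.
have [c hc] := (bal_l_exact ep sp b).1 b0.
have [d hd] := fl _ _ i inj c; exists d; rewrite -hc -hd.
by apply: bal_ext => x y /=; rewrite h.
Qed.

Lemma bal_r_flat_exact (E : lmodType R^c) (A B N : lmodType R)
    (f : {linear A -> B}) (g : {linear B -> N}) :
      flat_right E -> exact_at f g ->
  exact_at (bal_r g : bal E N -> bal E B) (bal_r f : bal E B -> bal E A).
Proof.
move=> /flat_rightP fl e b; split=> [b0|[c <-]]; last first.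
  by apply: bal_ext => x y /=; rewrite (exact_comp0 y e) bal0r.
have [I [p [i [sp inj h]]]] := image_exists g.
have ep : exact_at f p.
  move=> y; rewrite -e -h; split=> [->|]; first by rewrite linear0.
  by move=> iy; apply: inj; rewrite iy linear0.
have [c hc] := (bal_r_exact ep sp b).1 b0.
have [d hd] := fl _ _ i inj c; exists d; rewrite -hc -hd.
by apply: bal_ext => x y /=; rewrite h.
Qed.

End BalExact.

(** * Flat resolutions and balance of Tor *)

Section Resolutions.

(** Covers and their kernels are spliced. Each step is packed into one dependent pair, so that a
    single choice yields a function that can be iterated. *)
Lemma resolution_exists (R : pzRingType) (cX : lmodType R -> Prop) :
  (forall M : lmodType R, exists (X : lmodType R) (p : {linear X -> M}),
    cX X /\ surj p) ->
  forall M : lmodType R, exists (X : nat -> lmodType R)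
    (d : forall i, {linear X i.+1 -> X i}) (e : {linear X 0 -> M}),
    (forall i, cX (X i)) /\ exact_resseq d e.
Proof.
move=> cover M.
have step (N : lmodType R) : exists S : {X : lmodType R & {K : lmodType R &
    ({linear X -> N} * {linear K -> X})%type}},
    cX (projT1 S) /\ ses (projT2 (projT2 S)).2 (projT2 (projT2 S)).1.
  have [X [p [cXX sp]]] := cover N; have [K [i h]] := ses_of_surj sp.
  by exists (existT _ X (existT _ K (p, i))).
pose st N := projT1 (cid (step N)); have hst N := projT2 (cid (step N)).
pose Om (N : lmodType R) : lmodType R := projT1 (projT2 (st N)).
pose Z i := iter i Om M.
pose X i : lmodType R := projT1 (st (Z i)).
pose p i : {linear X i -> Z i} := (projT2 (projT2 (st (Z i)))).1.
pose k i : {linear Z i.+1 -> X i} := (projT2 (projT2 (st (Z i)))).2.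
have hp i : ses (k i) (p i) by case: (hst (Z i)).
exists X, (fun i => k i \o p i.+1), (p 0); split=> [i|].
  by case: (hst (Z i)).
split.
- move=> i y; have [injk _ _] := hp i; have [_ e' _] := hp i.+1.
  have [_ _ s'] := hp i.+2; split => [/= h|[x <-] /=].
    have /e' [z <-] : p i.+1 y = 0 by apply: injk; rewrite h linear0.
    by have [x <-] := s' z; exists x.
  by rewrite (exact_comp0 _ e') linear0.
- move=> y; have [_ e _] := hp 0; have [_ _ s1] := hp 1.
  split=> [/e [z <-]|[x <-]]; first by have [x <-] := s1 z; exists x.
  exact: (exact_comp0 (p 1 x) e).
- by case: (hp 0).
Qed.

Lemma resseq_shift (R : pzRingType) (M : lmodType R)
    (F : nat -> lmodType R) (d : forall i, {linear F i.+1 -> F i})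
    (e : {linear F 0 -> M}) : exact_resseq d e ->
  exists (K : lmodType R) (k : {linear K -> F 0}) (p : {linear F 1 -> K}),
  [/\ ses k e, forall x, k (p x) = d 0 x & exact_resseq (fun i => d i.+1) p].
Proof.
move=> [h1 h0 se]; have [K [k [inj ex]]] := ker_exists e.
have [|p hp] := @factor_inj R K (F 0) (F 1) k (d 0) inj.
  by move=> x; apply/ex; apply: (exact_comp0 x h0).
exists K, k, p; split=> //; split=> // y.
  rewrite -h1 -hp; split=> [->|]; first by rewrite linear0.
  by move=> ky; apply: inj; rewrite ky linear0.
have /h0 [x hx] : e (k y) = 0 by apply: (exact_comp0 y ex).
by exists x; apply: inj; rewrite hp.
Qed.

Definition right_flat_res (R : pzRingType) (E : lmodType R^c)
  (Q : nat -> lmodType R^c)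
    (d : forall i, {linear Q i.+1 -> Q i}) (e : {linear Q 0 -> E}) : Prop :=
  (forall i, flat_right (Q i)) /\ exact_resseq d e.

Definition left_flat_res (R : pzRingType) (M : lmodType R)
  (F : nat -> lmodType R)
    (d : forall i, {linear F i.+1 -> F i}) (e : {linear F 0 -> M}) : Prop :=
  (forall i, flat_left (F i)) /\ exact_resseq d e.

Lemma right_flat_res_exists (R : pzRingType) (E : lmodType R^c) :
  exists Q d e, @right_flat_res R E Q d e.
Proof.
apply: resolution_exists => M; have [p sp] := dsum_cover M.
exists (dsum (R^c^o : lmodType R^c) M), p; split=> //.
exact/flat_right_dsum/flat_right_regular.
Qed.

Lemma left_flat_res_exists (R : pzRingType) (M : lmodType R) :
  exists F d e, @left_flat_res R M F d e.
Proof.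
apply: resolution_exists => N; have [p sp] := dsum_cover N.
exists (dsum (R^o : lmodType R) N), p; split=> //.
exact/flat_left_dsum/flat_left_regular.
Qed.

End Resolutions.

Section TorComplex.
Variable R : pzRingType.

Lemma bal_l_comp0 (M : lmodType R) (A B N : lmodType R^c)
    (f : {linear A -> B}) (g : {linear B -> N}) (b : bal N M) :
  (forall x, g (f x) = 0) -> bal_l f (bal_l g b) = 0.
Proof. by move=> gf; apply: bal_ext => x y /=; rewrite gf bal0l. Qed.

Lemma bal_r_comp0 (E : lmodType R^c) (A B N : lmodType R)
    (f : {linear A -> B}) (g : {linear B -> N}) (b : bal E N) :
  (forall x, g (f x) = 0) -> bal_r f (bal_r g b) = 0.
Proof. by move=> gf; apply: bal_ext => x y /=; rewrite gf bal0r. Qed.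

Lemma bal_map_comm (E E' : lmodType R^c) (M M' : lmodType R)
    (f : {linear E' -> E}) (g : {linear M' -> M}) (b : bal E M) :
  bal_r g (bal_l f b) = bal_l f (bal_r g b).
Proof. exact: bal_ext. Qed.

Section RightResolution.
Variables (E : lmodType R^c) (Q : nat -> lmodType R^c)
  (d : forall i, {linear Q i.+1 -> Q i}) (e : {linear Q 0 -> E}).
Hypothesis hQ : right_flat_res d e.

(* Tor_{i+1}(E, M) = 0 *)
Definition TorS_eq0_res (i : nat) (M : lmodType R) : Prop :=
  exact_at (bal_l (d i) : bal (Q i) M -> bal (Q i.+1) M)
           (bal_l (d i.+1) : bal (Q i.+1) M -> bal (Q i.+2) M).

Let dd i (M : lmodType R) (b : bal (Q i) M) :
  bal_l (d i.+1) (bal_l (d i) b) = 0.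
Proof.
by apply: bal_l_comp0 => x; case: hQ => _ [/(_ i) h _ _];
  apply: (exact_comp0 x h).
Qed.

Let de (M : lmodType R) (b : bal E M) : bal_l (d 0) (bal_l e b) = 0.
Proof.
by apply: bal_l_comp0 => x; case: hQ => _ [_ h _]; apply: (exact_comp0 x h).
Qed.

Lemma TorS_eq0_res_flat i (M : lmodType R) : flat_left M -> TorS_eq0_res i M.
Proof. by move=> fM; apply: bal_l_flat_exact => //; case: hQ => _ []. Qed.

Variables (A B N : lmodType R) (f : {linear A -> B}) (g : {linear B -> N}).
Hypothesis hfg : ses f g.

Let row i : ses (bal_r g : bal (Q i) N -> bal (Q i) B)
  (bal_r f : bal (Q i) B -> bal (Q i) A).
Proof. by apply: bal_r_ses => //; case: hQ. Qed.

Lemma TorS_eq0_res_right i : TorS_eq0_res i B -> TorS_eq0_res i.+1 N ->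
  TorS_eq0_res i A.
Proof.
move=> hB hN; have [i3 _ _] := row i.+3.
by apply: (chase_right _ _ _ _ _ _ (row i.+1) (row i.+2) i3 hB hN) => b;
  first [exact: bal_map_comm | exact: dd].
Qed.

Lemma TorS_eq0_res_left i : TorS_eq0_res i A -> TorS_eq0_res i.+1 B ->
  TorS_eq0_res i.+1 N.
Proof.
move=> hA hB; have [_ _ s0] := row i.
by apply: (chase_left _ _ _ _ _ _ (row i.+1) (row i.+2) s0 hA hB) => b;
  first [exact: bal_map_comm | exact: dd].
Qed.

Lemma Tor1_eq0_res_left : surj (bal_r f : bal E B -> bal E A) ->
  TorS_eq0_res 0 B -> TorS_eq0_res 0 N.
Proof.
move=> s0 hB; have [_ [_ h se]] := hQ.
by apply: (chase_left _ _ _ _ _ _ (row 0)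
  (row 1) s0 (bal_l_exact h se) hB) => b;
  first [exact: bal_map_comm | exact: dd | exact: de].
Qed.

Lemma Tor1_eq0_res_surj : TorS_eq0_res 0 N ->
  surj (bal_r f : bal E B -> bal E A).
Proof.
move=> hN; have [_ [_ h se]] := hQ; have [i2 _ _] := row 2.
by apply: (chase_surj _ _ _ _ _ _ (row 0) (row 1) i2 (bal_l_inj se)
  (bal_l_exact h se) hN) => b;
  first [exact: bal_map_comm | exact: dd | exact: de].
Qed.

End RightResolution.

Lemma left_flat_res_shift (M : lmodType R) F d e : @left_flat_res R M F d e ->
  exists (K : lmodType R) (k : {linear K -> F 0}) (p : {linear F 1 -> K}),
  [/\ ses k e, forall x, k (p x) = d 0 x &
      @left_flat_res R K (fun i => F i.+1) (fun i => d i.+1) p].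
Proof.
by move=> [fl /resseq_shift [K [k [p [hk kp res]]]]]; exists K, k, p.
Qed.

Section Balance.
Variables (E : lmodType R^c) (Q : nat -> lmodType R^c)
  (d : forall i, {linear Q i.+1 -> Q i}) (e : {linear Q 0 -> E}).
Hypothesis hQ : right_flat_res d e.

(** Shifting along [K -> F 0 -> M] lowers the degree down to Tor_1, where exactness of either
    complex amounts to surjectivity of [bal_r k], that is, to injectivity of the map from E (x) K to
    E (x) F 0. *)
Lemma TorS_eq0_res_balance i (M : lmodType R) F dF eF :
  @left_flat_res R M F dF eF ->
  TorS_eq0_res d i M <-> exact_at (bal_r (dF i) : bal E _ -> bal E _)
                        (bal_r (dF i.+1) : bal E _ -> bal E _).
Proof.
elim: i M F dF eF => [|i IH] M F dF eF hF;
  have [K [k [p [hk kp hF']]]] := left_flat_res_shift hF.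
  have fl0 : flat_left (F 0) by case: hF.
  transitivity (surj (bal_r k : bal E _ -> bal E _)).
    split; first exact: Tor1_eq0_res_surj hQ _ _ _ _ _ hk.
    by move=> h; apply: (Tor1_eq0_res_left hQ hk) => //;
      apply: (TorS_eq0_res_flat hQ).
  have [_ [_ ex sp]] := hF'; have [_ [e0 _ _]] := hF.
  have eb := bal_r_exact (E := E) ex sp.
  have ip := bal_r_inj (E := E) sp.
  have kpb b : bal_r p (bal_r k b) = bal_r (dF 0) b :> bal E _.
    by apply: bal_ext => x y /=; rewrite kp.
  split=> [h b|h b].
    split=> [/eb [c <-]|[c <-]].
      by have [a <-] := h c; exists a.
    by apply: bal_r_comp0 => x; apply: (exact_comp0 x (e0 0)).
  have [|c hc] := (h (bal_r p b)).1.
    by apply: bal_r_comp0 => x; apply: (exact_comp0 x ex).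
  by exists c; apply: ip; rewrite kpb.
rewrite -(IH _ _ _ _ hF'); have fl0 : flat_left (F 0) by case: hF.
split; first by apply: (TorS_eq0_res_right hQ hk);
  apply: (TorS_eq0_res_flat hQ).
by move=> h; apply: (TorS_eq0_res_left hQ hk h); apply: (TorS_eq0_res_flat hQ).
Qed.

End Balance.

(** Index [i] stands for Tor_{i+1}(E, M) = 0, so only positive degrees occur. One flat resolution is
    asked for; by [TorS_eq0_left] and [TorS_eq0_right] any flat resolution of either argument
    decides the matter. *)
Definition TorS_eq0 (E : lmodType R^c) (i : nat) (M : lmodType R) : Prop :=
  exists F d e, @left_flat_res R M F d e /\
  exact_at (bal_r (d i) : bal E _ -> bal E _)
    (bal_r (d i.+1) : bal E _ -> bal E _).

Lemma TorS_eq0_right E i M Q d e :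
  @right_flat_res R E Q d e -> TorS_eq0 E i M <-> TorS_eq0_res d i M.
Proof.
move=> hQ; split => [[F [dF [eF [hF]]]]|h].
  by rewrite -(TorS_eq0_res_balance hQ i hF).
have [F [dF [eF hF]]] := left_flat_res_exists M.
by exists F, dF, eF; split=> //; rewrite -(TorS_eq0_res_balance hQ i hF).
Qed.

Lemma TorS_eq0_left E i M F d e : @left_flat_res R M F d e -> TorS_eq0 E i M <->
  exact_at (bal_r (d i) : bal E _ -> bal E _)
    (bal_r (d i.+1) : bal E _ -> bal E _).
Proof.
move=> hF; have [Q [dQ [eQ hQ]]] := right_flat_res_exists E.
by rewrite (TorS_eq0_right i M hQ) (TorS_eq0_res_balance hQ i hF).
Qed.

Lemma TorS_eq0_flat E i M : flat_left M -> TorS_eq0 E i M.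
Proof.
move=> fM; have [Q [dQ [eQ hQ]]] := right_flat_res_exists E.
by rewrite (TorS_eq0_right i M hQ); apply: (TorS_eq0_res_flat hQ).
Qed.

Lemma TorS_eq0_flat_right E i M : flat_right E -> TorS_eq0 E i M.
Proof.
move=> fE; have [F [d [e hF]]] := left_flat_res_exists M.
rewrite (TorS_eq0_left _ _ hF); apply: bal_r_flat_exact => //.
by case: hF => _ [].
Qed.

Section LongExact.
Variables (E : lmodType R^c) (A B N : lmodType R).
Variables (f : {linear A -> B}) (g : {linear B -> N}).
Hypothesis hfg : ses f g.

(** A fixed flat resolution of [E] makes the dual rows of the given sequence short exact; for
    sequences in the first argument a resolution of [M] does the same. *)
Lemma TorS_eq0_sub i : TorS_eq0 E i B -> TorS_eq0 E i.+1 N -> TorS_eq0 E i A.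
Proof.
have [Q [dQ [eQ hQ]]] := right_flat_res_exists E.
rewrite !(TorS_eq0_right _ _ hQ); exact: (TorS_eq0_res_right hQ hfg).
Qed.

Lemma TorS_eq0_quot i : TorS_eq0 E i A -> TorS_eq0 E i.+1 B ->
  TorS_eq0 E i.+1 N.
Proof.
have [Q [dQ [eQ hQ]]] := right_flat_res_exists E.
rewrite !(TorS_eq0_right _ _ hQ); exact: (TorS_eq0_res_left hQ hfg).
Qed.

Lemma TorS_eq0_quot0 : surj (bal_r f : bal E B -> bal E A) -> TorS_eq0 E 0 B ->
  TorS_eq0 E 0 N.
Proof.
have [Q [dQ [eQ hQ]]] := right_flat_res_exists E.
rewrite !(TorS_eq0_right _ _ hQ); exact: (Tor1_eq0_res_left hQ hfg).
Qed.

Lemma TorS_eq0_surj : TorS_eq0 E 0 N -> surj (bal_r f : bal E B -> bal E A).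
Proof.
have [Q [dQ [eQ hQ]]] := right_flat_res_exists E.
rewrite (TorS_eq0_right _ _ hQ); exact: (Tor1_eq0_res_surj hQ hfg).
Qed.

End LongExact.

Section LongExactLeft.
Variables (M : lmodType R) (A B N : lmodType R^c).
Variables (f : {linear A -> B}) (g : {linear B -> N}).
Hypothesis hfg : ses f g.

Let row F d e (hF : @left_flat_res R M F d e) i :
  ses (bal_l g : bal N (F i) -> bal B (F i))
    (bal_l f : bal B (F i) -> bal A (F i)).
Proof. by apply: bal_l_ses => //; case: hF. Qed.

Let dd F d e (hF : @left_flat_res R M F d e) E i (b : bal E (F i)) :
  bal_r (d i.+1) (bal_r (d i) b) = 0.
Proof.
by apply: bal_r_comp0 => x; case: hF => _ [/(_ i) h _ _];
  apply: (exact_comp0 x h).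
Qed.

Lemma TorS_eq0_mid_l i : TorS_eq0 A i M -> TorS_eq0 N i M -> TorS_eq0 B i M.
Proof.
have [F [d [e hF]]] := left_flat_res_exists M.
rewrite !(TorS_eq0_left _ _ hF) => hA hN; have [_ _ s0] := row hF i.
by apply: (chase_mid (u0 := bal_l g) _ _ _ _ _ (row hF i.+1)
  (row hF i.+2) s0 hN hA) => b;
  first [exact/esym/bal_map_comm | exact: (dd hF)].
Qed.

Lemma TorS_eq0_sub_l i : TorS_eq0 B i M -> TorS_eq0 N i.+1 M -> TorS_eq0 A i M.
Proof.
have [F [d [e hF]]] := left_flat_res_exists M.
rewrite !(TorS_eq0_left _ _ hF) => hB hN; have [i3 _ _] := row hF i.+3.
by apply: (chase_right _ _ _ _ _ _ (row hF i.+1) (row hF i.+2) i3 hB hN) => b;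
  first [exact/esym/bal_map_comm | exact: (dd hF)].
Qed.

Lemma TorS_eq0_quot_l i : TorS_eq0 A i M -> TorS_eq0 B i.+1 M ->
  TorS_eq0 N i.+1 M.
Proof.
have [F [d [e hF]]] := left_flat_res_exists M.
rewrite !(TorS_eq0_left _ _ hF) => hA hB; have [_ _ s0] := row hF i.
by apply: (chase_left _ _ _ _ _ _ (row hF i.+1) (row hF i.+2) s0 hA hB) => b;
  first [exact/esym/bal_map_comm | exact: (dd hF)].
Qed.

End LongExactLeft.

End TorComplex.

(** * G_C-flat modules *)

Section Retracts.
Variable R : pzRingType.

Definition retract (M N : lmodType R) : Prop :=
  exists (s : {linear M -> N}) (p : {linear N -> M}), forall x, p (s x) = x.

Lemma retract_trans (M N K : lmodType R) :
  retract M N -> retract N K -> retract M K.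
Proof.
move=> [s [p h]] [s' [p' h']]; exists (s' \o s), (p \o p') => x /=.
by rewrite h' h.
Qed.

Lemma lin_iso_inverse (M N : lmodType R) (f : {linear M -> N}) : bijective f ->
  exists g : {linear N -> M}, cancel f g /\ cancel g f.
Proof.
move=> bf; have inj := bij_inj bf; have [f' _ fK'] := bf.
have [|g hg] := @factor_inj R M N N f idfun inj; first by move=> x;
  exists (f' x).
by exists g; split=> x //; apply: inj; rewrite hg.
Qed.

Lemma bijective_inj_surj (U V : Type) (f : U -> V) :
  injective f -> (forall y, exists x, f x = y) -> bijective f.
Proof.
move=> inj /choice [g hg]; exists g => // x; apply: inj; exact: hg.
Qed.

End Retracts.

Section Characters.
Variable R : pzRingType.

Lemma charmod0 (M : lmodType R) (f : charmod M) : f 0 = 0.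
Proof. by apply: (@addrI _ (f 0)); rewrite -charmodD !addr0. Qed.

Lemma char_map_subproof (M N : lmodType R) (g : {linear M -> N})
  (f : charmod N) :
  (fun x => f (g x)) \in char_pred (M := M).
Proof.
apply/asboolP => x y; have /asboolP h := charmodP f.
by rewrite linearB h.
Qed.

Definition char_map_fun (M N : lmodType R) (g : {linear M -> N})
  (f : charmod N) :
  charmod M := Charmod (char_map_subproof g f).

Lemma char_map_linear (M N : lmodType R) (g : {linear M -> N}) :
  linear (char_map_fun g).
Proof.
move=> a x y; apply: charmod_ext => z.
exact: (congr1 (fun w => x w + y (g z)) (esym (linearZ_LR g (a : R) z))).
Qed.

Definition char_map (M N : lmodType R) (g : {linear M -> N}) :
  {linear charmod N -> charmod M} := mk_lin (char_map_linear g).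

Lemma char_map_ses (A B N : lmodType R) (f : {linear A -> B})
  (g : {linear B -> N}) :
  ses f g -> ses (char_map g) (char_map f).
Proof.
move=> [inj e sg]; split.
- move=> x y h; apply: charmod_ext => n; have [b <-] := sg n.
  exact: (congr1 (fun k : charmod B => k b) h).
- move=> x; split=> [x0|[y <-]]; last first.
    by apply: charmod_ext => a /=; rewrite (exact_comp0 a e) charmod0.
  have /asboolP hx := charmodP x.
  have [_ h] := (dual_exact f g).1 e.
  have [|y hy] := h (mk_add hx).
    by move=> a; apply: (congr1 (fun k : charmod A => k a) x0).
  have hy' : (y : N -> QZ) \in char_pred (M := N) by apply/asboolP => a b;
    rewrite raddfB.
  by exists (Charmod hy'); apply: charmod_ext => b /=; rewrite hy.
- move=> x; have /asboolP hx := charmodP x.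
  have [y hy] := @QZ_injective A B f (mk_add hx) inj.
  have hy' : (y : B -> QZ) \in char_pred (M := B) by apply/asboolP => a b;
    rewrite raddfB.
  by exists (Charmod hy'); apply: charmod_ext => b /=; rewrite hy.
Qed.

Lemma lin_of_bal (E : lmodType R^c) (M : lmodType R) (b : bal E M) :
  exists h : {linear E -> charmod M}, forall x y, h x y = b x y.
Proof.
have hb x : b x \in char_pred (M := M).
  by apply/asboolP => y z; rewrite balDr balNr.
have l : linear (fun x => Charmod (hb x)).
  by move=> a x x'; apply: charmod_ext => y /=; rewrite balDl balZ.
by exists (mk_lin l).
Qed.

Lemma bal_of_lin_subproof (E : lmodType R^c) (M : lmodType R)
  (h : {linear E -> charmod M}) : balanced (fun x y => h x y).
Proof.
split=> [x x' y|x y y'|x r y]; [by rewrite linearD | exact: charmodD|].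
by rewrite linearZ.
Qed.

Definition bal_of_lin (E : lmodType R^c) (M : lmodType R)
  (h : {linear E -> charmod M}) :=
  mk_bal (bal_of_lin_subproof h).

Lemma retract_char (M N : lmodType R) :
  retract M N -> retract (charmod M) (charmod N).
Proof.
move=> [s [p h]]; exists (char_map p), (char_map s) => f.
by apply: charmod_ext => x /=; rewrite h.
Qed.

End Characters.

Section RelativeClasses.
Variables (R : pzRingType) (C : lmodType R).
Implicit Types (E : lmodType R^c) (M N X : lmodType R).

(** The complement of a retract is the kernel of the retraction. *)
Lemma IC_injectiveP E :
  IC_injective C E <-> exists I : Type, retract E (I -> charmod C).
Proof.
split=> [[I [E' [f bf]]]|[I [s [p ps]]]].
  have [g [fK gK]] := lin_iso_inverse bf.
  have l : linear (fun x : E => (x, 0 : E')).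
    by move=> a x y; congr (_, _); rewrite /= scaler0 addr0.
  by exists I, (f \o mk_lin l), (fst \o g) => x /=; rewrite fK.
have [K [k [injk ek]]] := ker_exists p.
have l : linear (fun x : E * K => s x.1 + k x.2).
  by move=> a x y; rewrite /= !linearP scalerDr addrACA.
exists I, K, (mk_lin l); apply: bijective_inj_surj => [|z].
  apply: inj_ker0 => -[x y] /= h.
  have x0 : x = 0.
    by have := congr1 p h; rewrite linearD linear0 ps (exact_comp0 y ek) addr0.
  move: h; rewrite x0 linear0 add0r -(linear0 k) => /injk ->.
  by [].
have /ek [y hy] : p (z - s (p z)) = 0 by rewrite linearB ps subrr.
by exists (p z, y); rewrite /= hy addrC subrK.
Qed.

Lemma IC_injective_retract E E' :
  retract E E' -> IC_injective C E' -> IC_injective C E.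
Proof.
move=> r /IC_injectiveP [I r']; apply/IC_injectiveP; exists I.
exact: retract_trans r'.
Qed.

Lemma TorS_eq0_retract_l E E' i M :
  retract E E' -> TorS_eq0 E' i M -> TorS_eq0 E i M.
Proof.
move=> [s [p ps]] [F [d [e [hF h]]]]; exists F, d, e; split=> // b.
split=> [b0|[c <-]]; last first.
  by apply: bal_r_comp0 => x; case: hF => _ [/(_ i) h' _ _];
    apply: (exact_comp0 x h').
have [|c hc] := (h (bal_l p b)).1.
  by rewrite bal_map_comm b0 raddf0.
exists (bal_l s c); rewrite bal_map_comm hc.
by apply: bal_ext => x y /=; rewrite ps.
Qed.

(** Balanced maps on [Q i] and [M] are linear maps from [Q i] to [charmod M], so vanishing of Tor is
    exactness of a Hom complex into [charmod M]. Such exactness passes to powers and retracts of the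
    target. *)
Lemma TorS_eq0_char_retract E i M N : TorS_eq0 E i N ->
  (exists I : Type, retract (charmod M) (I -> charmod N)) -> TorS_eq0 E i M.
Proof.
have [Q [d [e hQ]]] := right_flat_res_exists E.
rewrite !(TorS_eq0_right _ _ hQ) => hN [I [s [p ps]]] b.
split=> [b0|[c <-]]; last first.
  by apply: bal_l_comp0 => x; case: hQ => _ [/(_ i) h' _ _];
    apply: (exact_comp0 x h').
have [h hh] := lin_of_bal b.
have /choice [c hc] j : exists c : bal (Q i) N, forall x y,
    c (d i x) y = s (h x) j y.
  have l : linear (fun x => s (h x) j) by move=> a x y; rewrite !linearP.
  have [|c hc] := (hN (bal_of_lin (mk_lin l))).1.
    apply: bal_ext => x y /=.
    have -> : h (d i.+1 x) = 0.
      apply: charmod_ext => z; rewrite hh.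
      exact: (congr1 (fun k => bal_fun k x z) b0).
    by rewrite linear0.
  by exists c => x y; have := congr1 (fun k => bal_fun k x y) hc.
have /choice [g hg] j : exists g :
  {linear Q i -> charmod N}, forall x y, g x y = c j x y.
  exact: lin_of_bal.
have l : linear (fun x j => g j x) by move=> a x y; apply: funext => j;
  rewrite linearP.
exists (bal_of_lin (p \o mk_lin l)); apply: bal_ext => x y /=.
rewrite -hh -[in RHS](ps (h x)); congr (charmod_fun (p _) y).
apply: funext => j; apply: charmod_ext => z.
by rewrite hg hc.
Qed.

Definition TorIC M : Prop := forall E, IC_injective C E -> forall i,
  TorS_eq0 E i M.

(** The right half of the sequence defining G_C-flatness, with exactness after tensoring already
    dualised. *)
Definition GC_cores M : Prop :=
  exists (D : nat -> lmodType R) (e : {linear M -> D 0})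
         (d : forall n, {linear D n -> D n.+1}),
  [/\ forall n, FC_flat C (D n), exact_coseq e d &
      forall E, IC_injective C E ->
        [/\ surj (bal_r e : bal E _ -> bal E _),
            exact_at (bal_r (d 0) : bal E _ -> bal E _)
              (bal_r e : bal E _ -> bal E _) &
            forall n, exact_at (bal_r (d n.+1) : bal E _ -> bal E _)
              (bal_r (d n) : bal E _ -> bal E _)]].

(** The left half of a defining sequence is a flat resolution of [M], and its exactness after
    tensoring is vanishing of Tor. As the latter does not depend on the resolution, any flat
    resolution can be glued to the coresolution. *)
Lemma GC_flatP M : GC_flat C M <-> TorIC M /\ GC_cores M.
Proof.
split.
  move=> [F [D [dF [e [dD [flF fcD [x1 x2 x3 x4] tau [j [injj ej]]]]]]]].
  have [|e' he'] := @factor_inj R M _ _ j e injj.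
    by move=> x; apply/ej; exists x.
  have se' : surj e'.
    move=> m; have /ej [x hx] : exists z, j z = j m by exists m.
    by exists x; apply: injj; rewrite he'.
  have res : left_flat_res dF e'.
    split=> //; split=> // y; rewrite -x2 -he'.
    split=> [->|]; first by rewrite linear0.
    by move=> h; apply: injj; rewrite h linear0.
  have ke' E (b : bal E (D 0)) : bal_r e' (bal_r j b) = bal_r e b.
    by apply: bal_ext => x y /=; rewrite he'.
  have inje' E := @bal_r_inj R E _ _ e' se'.
  split.
    by move=> E hE i; rewrite (TorS_eq0_left _ _ res) -tens_map_exact;
      case: (tau E hE).
  exists D, j, dD; split=> //; first by split=> // y; rewrite x3 ej.
  move=> E hE; have [t1 t2 t3 t4] := tau E hE.
  move: t2 t3; rewrite !tens_map_exact => t2 t3; split.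
  - move=> c; have [|b hb] := (t2 (bal_r e' c)).1.
      by apply: bal_r_comp0 => x;
        rewrite (exact_comp0 _ (_ : exact_at (dF 0) e')) //; case: res => _ [].
    by exists b; apply: inje'; rewrite ke'.
  - move=> b; rewrite -t3 -ke'; split=> [->|h]; first exact: raddf0.
    by apply: inje'; rewrite h raddf0.
  - by move=> n; rewrite -tens_map_exact.
move=> [tor [D [j [dD [fcD [injj ej edD] tau]]]]].
have [F [dF [e res]]] := left_flat_res_exists M.
have [flF [x1 x2 se]] := res.
have eE y : (j \o e) y = 0 <-> e y = 0.
  by split=> /= [h|->]; [apply: injj; rewrite h linear0 | rewrite linear0].
have im y : (exists x, (j \o e) x = y) <-> (exists z, j z = y).
  split=> [[x <-]|[z <-]]; first by exists (e x).
  by have [x <-] := se z; exists x.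
exists F, D, dF, (j \o e), dD; split=> //.
- by split=> // y; [rewrite eE | rewrite im].
- move=> E hE; have [t1 t2 t3] := tau E hE.
  have inje := @bal_r_inj R E _ _ e se.
  have ebe := @bal_r_exact R E _ _ _ (dF 0) e x2 se.
  have ke (b : bal E (D 0)) : bal_r (j \o e) b = bal_r e (bal_r j b).
    exact: bal_ext.
  split=> [n|||n]; rewrite tens_map_exact //.
  + by rewrite -(TorS_eq0_left _ _ res); apply: tor.
  + move=> b; rewrite ebe; split=> [[c <-]|[c <-]].
      by have [a <-] := t1 c; exists a; rewrite ke.
    by exists (bal_r j c); rewrite ke.
  + move=> b; rewrite -t2 ke; split=> [h|->]; last exact: raddf0.
    by apply: inje; rewrite h raddf0.
- by exists j; split=> // y; rewrite im.
Qed.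

Lemma GC_TorIC M : GC_flat C M -> TorIC M.
Proof. by case/GC_flatP. Qed.

(** The short exact sequences given by the second hypothesis are spliced. They stay exact after
    tensoring because every cokernel lies in [W] again and so has no Tor_1. *)
Lemma GC_coind (W : lmodType R -> Prop) :
  (forall N, W N -> TorIC N) ->
  (forall N, W N -> exists (X N' : lmodType R) (f : {linear N -> X})
    (g : {linear X -> N'}),
     [/\ ses f g, FC_flat C X & W N']) ->
  forall N, W N -> GC_flat C N.
Proof.
move=> Wtor Wstep N WN; apply/GC_flatP; split; first exact: Wtor.
(* Membership in [W] travels with the module, so the step can be iterated. *)
have step (S : {M : lmodType R | W M}) :
    exists T : {X : lmodType R & {S' : {M : lmodType R | W M} &
      ({linear sval S -> X} * {linear X -> sval S'})%type}},
    FC_flat C (projT1 T) /\ ses (projT2 (projT2 T)).1 (projT2 (projT2 T)).2.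
  have [X [N' [f [g [h fX WN']]]]] := Wstep _ (svalP S).
  by exists (existT _ X (existT _ (exist _ N' WN') (f, g))).
pose st S := projT1 (cid (step S)); have hst S := projT2 (cid (step S)).
pose nxt S : {M : lmodType R | W M} := projT1 (projT2 (st S)).
pose Z i := iter i nxt (exist _ N WN).
pose D i : lmodType R := projT1 (st (Z i)).
pose f i : {linear sval (Z i) -> D i} := (projT2 (projT2 (st (Z i)))).1.
pose g i : {linear D i -> sval (Z i.+1)} := (projT2 (projT2 (st (Z i)))).2.
have hs i : ses (f i) (g i) by case: (hst (Z i)).
exists D, (f 0), (fun i => f i.+1 \o g i); split.
- by move=> i; case: (hst (Z i)).
- split.
  + by case: (hs 0).
  + move=> y; have [_ <- _] := hs 0; have [inj _ _] := hs 1.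
    by split=> /= [h|->]; [apply: inj; rewrite h linear0 | rewrite linear0].
  + move=> i y; have [_ e1 s1] := hs i.+1; have [inj _ _] := hs i.+2.
    have [_ _ s0] := hs i; split=> [/= h|[x <-] /=].
      have /e1 [z <-] : g i.+1 y = 0 by apply: inj; rewrite h linear0.
      by have [x <-] := s0 z; exists x.
    by rewrite (exact_comp0 _ e1) linear0.
- move=> E hE.
  have sf i : surj (bal_r (f i) : bal E _ -> bal E _).
    by apply: (TorS_eq0_surj (hs i)); apply: Wtor => //; apply: svalP.
  have ig i : injective (bal_r (g i) : bal E _ -> bal E _).
    by apply: bal_r_inj; case: (hs i).
  have efg i : exact_at (bal_r (g i) : bal E _ -> bal E _)
    (bal_r (f i) : bal E _ -> bal E _).
    by case: (hs i) => _ ee ss; apply: bal_r_exact.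
  have dE i (b : bal E (D i.+1)) :
    bal_r (f i.+1 \o g i) b = bal_r (g i) (bal_r (f i.+1) b).
    exact: bal_ext.
  split=> //.
  + move=> b; rewrite (efg 0); split=> [[c <-]|[c <-]].
      by have [a <-] := sf 1 c; exists a; rewrite dE.
    by exists (bal_r (f 1) c); rewrite dE.
  + move=> i b; transitivity (bal_r (f i.+1) b = 0).
      rewrite dE; split=> [h|->]; last exact: raddf0.
      by apply: ig; rewrite h raddf0.
    rewrite (efg i.+1); split=> [[c <-]|[c <-]].
      by have [a <-] := sf i.+2 c; exists a; rewrite dE.
    by exists (bal_r (f i.+2) c); rewrite dE.
Qed.

End RelativeClasses.

Section DirectSumMaps.
Variables (R : pzRingType) (S : choiceType).

Section Map.
Variables (A B : lmodType R) (f : {linear A -> B}).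

Lemma dsum_map_subproof (x : dsum A S) :
  fin_supp (fun s => f (submodule_val x s)).
Proof.
have [l [_ hl]] := dsumP x; exists l => s fs; apply: hl.
by apply: contra fs => /eqP ->; rewrite linear0.
Qed.

Definition dsum_map_fun (x : dsum A S) : dsum B S :=
  Submodule ((mem_submod (fin_supp0 B S)
    (@fin_suppD R B S) _).2 (dsum_map_subproof x)).

Lemma dsum_map_linear : linear dsum_map_fun.
Proof.
move=> a x y; apply: dsum_eq => s.
exact: (linearP f a (submodule_val x s) (submodule_val y s)).
Qed.

Definition dsum_map : {linear dsum A S -> dsum B S} := mk_lin dsum_map_linear.

Lemma dsum_map_delta s z : dsum_map (delta A s z) = delta B s (f z).
Proof. by apply: dsum_eq => t /=; case: eqP => // _; rewrite linear0. Qed.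

Lemma dsum_map_image (y : dsum B S) :
  (forall s, exists z, f z = submodule_val y s) -> exists x, dsum_map x = y.
Proof.
move=> /choice [z hz]; have [l hl] := dsum_decomp y.
exists (\sum_(s <- l) delta A s (z s)).
rewrite [RHS]hl linear_sum; apply: eq_bigr => s _.
by rewrite dsum_map_delta hz.
Qed.

End Map.

Lemma dsum_ses (A B N : lmodType R) (f : {linear A -> B}) (g : {linear B -> N})
  :
  ses f g -> ses (dsum_map f) (dsum_map g).
Proof.
move=> [inj e sg]; split.
- move=> x y h; apply: dsum_eq => s; apply: inj.
  exact: (congr1 (fun z : dsum B S => submodule_val z s) h).
- move=> y; split=> [h|[x <-]].
    apply: dsum_map_image => s; apply/e.
    exact: (congr1 (fun z : dsum N S => submodule_val z s) h).
  by apply: dsum_eq => s /=; apply: (exact_comp0 _ e).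
- by move=> y; apply: dsum_map_image => s; apply: sg.
Qed.

Lemma charmod_dsum (Z : lmodType R) :
  exists (r : {linear charmod (dsum Z S) -> (S -> charmod Z)})
         (t : {linear (S -> charmod Z) -> charmod (dsum Z S)}), cancel r t.
Proof.
have l : linear (fun (x : charmod (dsum Z S)) s => char_map (delta Z s) x).
  by move=> a x y; apply: funext => s; rewrite linearP.
have inj : injective (mk_lin l).
  move=> x y h; apply: charmod_ext.
  have /asboolP hx := charmodP x; have /asboolP hy := charmodP y.
  apply: (dsum_ext (f := mk_add hx) (g := mk_add hy)) => s z.
  exact: (congr1 (fun k : S -> charmod Z => k s z) h).
have [|t ht] := @factor_inj _ _ _ _ (mk_lin l) idfun inj; last first.
  by exists (mk_lin l), t => x; apply: inj; rewrite ht.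
move=> h.
pose ha s : {additive Z -> QZ} := mk_add (asboolW (charmodP (h s))).
have [x hx] := dsum_add_exists ha.
have hx' : (x : dsum Z S -> QZ) \in char_pred (M := dsum Z S).
  by apply/asboolP => a b; rewrite raddfB.
exists (Charmod hx'); apply: funext => s; apply: charmod_ext => z.
exact: hx.
Qed.

End DirectSumMaps.

Section GorensteinFlat.
Variables (R : pzRingType) (C : lmodType R).
Implicit Types (E : lmodType R^c) (M N X : lmodType R).

Lemma FC_flat_zero M : (forall x : M, x = 0) -> FC_flat C M.
Proof.
move=> M0; apply/IC_injectiveP; exists void.
have l (U V : lmodType R^c) : linear (fun _ : U => 0 : V).
  by move=> a x y; rewrite scaler0 addr0.
exists (mk_lin (l _ _)), (mk_lin (l _ _)) => x /=.
by apply: charmod_ext => y; rewrite (M0 y) !charmod0.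
Qed.

(** The character module of the sum is the [S]-fold power of [charmod X], hence a summand of a power
    of [charmod C] indexed by [S * I]. *)
Lemma FC_flat_dsum (X : lmodType R) (S : choiceType) :
  FC_flat C X -> FC_flat C (dsum X S).
Proof.
move=> /IC_injectiveP [I [s [p ps]]]; apply/IC_injectiveP; exists (S * I)%type.
have [r [t rt]] := charmod_dsum S X.
have l1 : linear (fun (x : S -> charmod X) (k : S * I) => s (x k.1) k.2).
  by move=> a x y; apply: funext => k;
    rewrite -[RHS]/((a *: s (x k.1) + s (y k.1)) k.2) -linearP.
have l2 : linear (fun (h : S * I -> charmod C) k => p (fun i => h (k, i))).
  move=> a x y; apply: funext => k.
  by rewrite -[RHS]/(a *: p (fun i => x (k, i)) + p (fun i => y (k, i)))
    -linearP.
exists (mk_lin l1 \o r), (t \o mk_lin l2) => x /=.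
rewrite -[RHS]rt; congr (t _); apply: funext => k /=.
by rewrite -[RHS]ps.
Qed.

Lemma TorIC_dsum M (S : choiceType) : TorIC C M -> TorIC C (dsum M S).
Proof.
move=> tor E hE i; have [Q [d [e hQ]]] := right_flat_res_exists E.
have /(TorS_eq0_right _ _ hQ) h := tor E hE i.
rewrite (TorS_eq0_right _ _ hQ) => b; split=> [b0|[c <-]]; last first.
  by apply: bal_l_comp0 => x; case: hQ => _ [/(_ i) h' _ _];
    apply: (exact_comp0 x h').
have /choice [c hc] s : exists c, bal_l (d i) c = bal_r (delta M s) b.
  apply/h; rewrite -bal_map_comm b0; exact: raddf0.
have [k hk] := bal_dsum_r c; exists k; apply: bal_dsum_ext_r => s.
by rewrite -hc -hk; apply: bal_ext.
Qed.

(** The cokernel of [N -> D 0] is the kernel of [d 1], and the tail of the coresolution serves it.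
    Its Tor_1 vanishes because [bal_r e] is surjective, the higher Tor by shifting. *)
Lemma GC_step N : GC_flat C N -> (forall X, FC_flat C X -> TorIC C X) ->
  exists (X N' : lmodType R) (f : {linear N -> X}) (g : {linear X -> N'}),
  [/\ ses f g, FC_flat C X & GC_flat C N'].
Proof.
move=> /GC_flatP [tor [D [e [d [fcD [inje eed edd] tau]]]]] torFC.
have [K [k [injk ek]]] := ker_exists (d 1).
have [|g hg] := @factor_inj R K _ _ k (d 0) injk.
  by move=> x; apply/ek; apply: (exact_comp0 _ (edd 0)).
have sg : surj g.
  move=> y; have /(edd 0) [x hx] : d 1 (k y) = 0 by apply: (exact_comp0 y ek).
  by exists x; apply: injk; rewrite hg.
have h : ses e g.
  split=> // y; rewrite -eed -hg; split=> [->|]; first by rewrite linear0.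
  by move=> ky; apply: injk; rewrite ky linear0.
exists (D 0), K, e, g; split=> //; apply/GC_flatP; split.
  move=> E hE [|i].
    by apply: (TorS_eq0_quot0 h); [case: (tau E hE) | apply: torFC].
  by apply: (TorS_eq0_quot h); [apply: tor | apply: torFC].
exists (fun i => D i.+1), k, (fun i => d i.+1); split=> //.
move=> E hE; have [t1 t2 t3] := tau E hE.
have ig : injective (bal_r g : bal E _ -> bal E _) by apply: bal_r_inj.
have kg (b : bal E (D 1)) : bal_r g (bal_r k b) = bal_r (d 0) b.
  by apply: bal_ext => x y /=; rewrite hg.
split=> //.
- move=> c; have [|b hb] := (t2 (bal_r g c)).1.
    by apply: bal_r_comp0 => x; case: h => _ h _; apply: (exact_comp0 x h).
  by exists b; apply: ig; rewrite kg.
- move=> b; rewrite -t3 -kg; split=> [->|hb]; first exact: raddf0.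
  by apply: ig; rewrite hb raddf0.
Qed.

End GorensteinFlat.

(** * Closure properties over a w^+-tilting module *)

Section Tilting.
Variables (R : pzRingType) (C : lmodType R).
Hypothesis hC : w_plus_tilting C.
Implicit Types (E : lmodType R^c) (M N X : lmodType R).

Lemma TorIC_tilting : TorIC C C.
Proof.
move=> E /IC_injectiveP [I r] i; apply: (TorS_eq0_retract_l r).
(* [Tor_eq0] speaks of projective resolutions and [TorS_eq0] of flat ones; a free resolution is
   both. *)
have [|P [d [e [hP res]]]] :=
    @resolution_exists R (fun P => projective P /\ flat_left P) _ C.
  move=> M; have [p sp] := dsum_cover M; exists (dsum R^o M), p; split=> //;
    split.
    exact/dsum_projective/projective_regular.
  exact/flat_left_dsum/flat_left_regular.
have fl : left_flat_res d e by split=> // j; case: (hP j).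
rewrite (TorS_eq0_left _ _ fl) -tens_map_exact.
have [h _] := hC; apply: (h I i.+1 _ P d e) => // j.
by case: (hP j).
Qed.

Lemma TorIC_FC X : FC_flat C X -> TorIC C X.
Proof.
move=> /IC_injectiveP hX E hE i; apply: (TorS_eq0_char_retract _ hX).
exact: TorIC_tilting.
Qed.

Lemma GC_cosyzygy N : GC_flat C N ->
  exists (X N' : lmodType R) (f : {linear N -> X}) (g : {linear X -> N'}),
  [/\ ses f g, FC_flat C X & GC_flat C N'].
Proof. by move=> h; apply: GC_step h TorIC_FC. Qed.

(** The coresolution is [X] itself followed by zero modules. *)
Lemma FC_GC X : FC_flat C X -> GC_flat C X.
Proof.
apply: GC_coind => N fN; first exact: TorIC_FC.
pose Z : lmodType R := (void -> R^o).
have Z0 (z : Z) : z = 0 by apply: funext => -[].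
have l : linear (fun _ : N => 0 : Z) by move=> a x y; rewrite scaler0 addr0.
exists N, Z, idfun, (mk_lin l); split=> //; last exact: FC_flat_zero.
split=> // [y|z]; first by split=> // _; exists y.
by exists 0; rewrite [RHS]Z0.
Qed.

Lemma GC_flat_zero M : (forall x : M, x = 0) -> GC_flat C M.
Proof. by move/FC_flat_zero/FC_GC. Qed.

Lemma GC_flat_dsum M (S : choiceType) : GC_flat C M -> GC_flat C (dsum M S).
Proof.
move=> hM; apply: (@GC_coind R C (fun N => exists2 M',
  GC_flat C M' & N = dsum M' S)).
- by move=> _ [M' hM' ->]; apply/TorIC_dsum/GC_TorIC.
- move=> _ [M' hM' ->]; have [X [N' [f [g [h fX gN]]]]] := GC_cosyzygy hM'.
  exists (dsum X S), (dsum N' S), (dsum_map S f), (dsum_map S g); split.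
  + exact: dsum_ses.
  + exact: FC_flat_dsum.
  + by exists N'.
- by exists M.
Qed.

Lemma GC_flat_regular : GC_flat C R^o.
Proof.
apply/GC_flatP; split; first by move=> E _ i;
  apply/TorS_eq0_flat/flat_left_regular.
have [_ [D [e [dD [fcD ex tau]]]]] := hC; exists D, e, dD; split=> // E hE.
have [t1 t2 t3] := tau E hE; split.
- exact/tens_map_inj.
- exact/tens_map_exact.
- by move=> n; apply/tens_map_exact.
Qed.

Definition GC_projective P : Prop := projective P /\ GC_flat C P.

Lemma GC_projective_cover M :
  exists (P : lmodType R) (p : {linear P -> M}), GC_projective P /\ surj p.
Proof.
have [p sp] := dsum_cover M; exists (dsum R^o M), p; split=> //; split.
  exact/dsum_projective/projective_regular.
exact/GC_flat_dsum/GC_flat_regular.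
Qed.

(** Coinduction on the hypothesis itself: by [GC_cosyzygy] the cokernel [N] again embeds in an
    F_C-flat module with G_C-flat cokernel. *)
Lemma GC_flat_sub_FC (A X N : lmodType R) (f : {linear A -> X})
  (g : {linear X -> N}) :
  ses f g -> FC_flat C X -> GC_flat C N -> GC_flat C A.
Proof.
move=> h fX gN.
apply: (@GC_coind R C (fun A => exists (X N : lmodType R) (f : {linear A -> X})
   (g : {linear X -> N}), [/\ ses f g, FC_flat C X & GC_flat C N])).
- move=> A' [X' [N' [f' [g' [h' fX' gN']]]]] E hE i; apply: (TorS_eq0_sub h').
    exact: TorIC_FC.
  exact: (GC_TorIC gN' hE).
- move=> A' [X' [N' [f' [g' [h' fX' gN']]]]]; exists X', N', f', g'; split=> //.
  exact: GC_cosyzygy.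
- by exists X, N, f, g.
Qed.

Section ExtensionClosed.
Hypothesis hext : ext_closed (GC_flat C).

Lemma GC_flat_ext (A B N : lmodType R) (f : {linear A -> B})
  (g : {linear B -> N}) :
  ses f g -> GC_flat C A -> GC_flat C N -> GC_flat C B.
Proof. by move=> [inj e sg]; apply: (hext inj e sg). Qed.

(** If [B] is embedded in an F_C-flat [X] with cokernel [B'], then [X / A] is an extension of [B']
    by [N], hence G_C-flat. *)
Lemma GC_flat_ker (A B N : lmodType R) (f : {linear A -> B})
  (g : {linear B -> N}) :
  ses f g -> GC_flat C B -> GC_flat C N -> GC_flat C A.
Proof.
move=> h gB gN; have [X [B' [j [k [hjk fX gB']]]]] := GC_cosyzygy gB.
have [Z [g' [h' [k' [h1 h2 _]]]]] := ses_noether h hjk.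
exact: (GC_flat_sub_FC h1 fX (GC_flat_ext h2 gN gB')).
Qed.

End ExtensionClosed.

End Tilting.

(** * Resolution dimensions *)

Section ResolutionLength.
Variables (R : pzRingType) (cX : lmodType R -> Prop).
Implicit Types M N K X : lmodType R.

(** Resolutions of length [n] by recursion on the first syzygy, the form suited to induction. *)
Fixpoint resn (n : nat) (M : lmodType R) : Prop :=
  if n is m.+1 then
    exists (K X : lmodType R) (f : {linear K -> X}) (g : {linear X -> M}),
      [/\ ses f g, cX X & resn m K]
  else cX M.

Hypothesis cX_iso : forall M N (f : {linear M -> N}), bijective f -> cX M ->
  cX N.

Lemma linear_0 M N : linear (fun _ : M => 0 : N).
Proof. by move=> a x y; rewrite scaler0 addr0. Qed.

Lemma has_resolutionP M n : has_resolution cX M n <-> resn n M.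
Proof.
split.
  elim: n M => [|n IH] M [X [d [e [hX X0 res]]]] /=.
    apply: (cX_iso (f := e)); last exact: hX.
    have [_ e0 se] := res; apply: bijective_inj_surj => //.
    by apply: inj_ker0 => x /e0 [y <-]; rewrite [y]X0 // linear0.
  have [K [k [p [hk _ res']]]] := resseq_shift res.
  exists K, (X 0), k, e; split=> //; first exact: hX.
  apply: IH; exists (fun i => X i.+1), (fun i => d i.+1), p; split=> // i hi.
    exact: hX.
  exact: X0.
elim: n M => [|n IH] M /=.
  move=> hM; pose Z : lmodType R := (void -> R^o).
  have Z0 (z : Z) : z = 0 by apply: funext => -[].
  pose X i : lmodType R := if i is 0 then M else Z.
  pose d i : {linear X i.+1 -> X i} := mk_lin (@linear_0 Z (X i)).
  exists X, d, idfun; split=> [[|i]|[|i]|] //.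
  split=> [[|i] y|y|y]; last by exists y.
  - by split=> // _; exists 0; rewrite [y]Z0.
  - by split=> // _; exists 0; rewrite [y]Z0.
  - by split=> [/= ->|[x <-]] //; exists 0.
move=> [K [Y [f [g [hfg hY /IH [X [d [e [hX X0 res]]]]]]]]].
pose X' i : lmodType R := if i is j.+1 then X j else Y.
pose d' i : {linear X' i.+1 -> X' i} :=
  match i return {linear X' i.+1 -> X' i} with
  | 0 => f \o e
  | j.+1 => d j
  end.
have [inj efg sg] := hfg; have [h1 h0 se] := res.
exists X', d', g; split.
- by move=> [|i] hi //=; apply: hX.
- by move=> [|i] hi //=; apply: X0.
- split=> [[|i]|y|] //; last 2 first.
  - exact: h1.
  - by rewrite efg; split=> [[x <-]|[x <-]];
    [have [z <-] := se x; exists z | exists (e x)].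
  move=> y; apply: (iff_trans _ (h0 y)) => /=; split=> [h|->];
    last exact: linear0.
  by apply: inj; rewrite h linear0.
Qed.

Lemma dim_le_least (P : nat -> Prop) n :
  dim_le (least P) n <-> exists2 k, (k <= n)%N & P k.
Proof.
rewrite /least; case: pselect => [h|h] /=; last first.
  by split=> // -[k _ Pk]; apply: h; exists k; apply/asboolP.
case: (ex_minnP h) => m /asboolP Pm mmin; split=> [mn|[k kn Pk]].
  by exists m.
by apply: leq_trans kn; apply: mmin; apply/asboolP.
Qed.

Hypothesis cX_zero : forall M, (forall x : M, x = 0) -> cX M.

(** A zero module is added at the far end. Thus a bound on the least length is the same as a
    resolution of exactly that length. *)
Lemma resnS n M : resn n M -> resn n.+1 M.
Proof.
elim: n M => [|n IH] M /=.
  move=> hM; pose Z : lmodType R := (void -> R^o).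
  have Z0 (z : Z) : z = 0 by apply: funext => -[].
  exists Z, M, (mk_lin (@linear_0 Z M)), idfun; split=> //; last exact: cX_zero.
  split=> [x y _|y|y]; first by rewrite (Z0 x) (Z0 y).
    by split=> [/= ->|[x <-]] //; exists 0.
  by exists y.
move=> [K [X [f [g [h hX /IH hK]]]]]; by exists K, X, f, g.
Qed.

Lemma dim_le_resdim M n : dim_le (resdim cX M) n <-> resn n M.
Proof.
rewrite /resdim dim_le_least; split=> [[k kn /has_resolutionP h]|h].
  rewrite -(subnK kn); elim: (n - k)%N => // m IH.
  by rewrite addSn; apply: resnS.
by exists n => //; apply/has_resolutionP.
Qed.

End ResolutionLength.

Lemma dim_le_sup (I : Type) (d : I -> option nat) n :
  dim_le (dim_sup d) n <-> forall i, dim_le (d i) n.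
Proof.
rewrite /dim_sup dim_le_least; split=> [[k kn h] i|h]; last by exists n.
by have := h i; case: (d i) => //= m mk; apply: leq_trans kn.
Qed.

Section IsoClosed.
Variable R : pzRingType.

Lemma GC_flat_iso (C M N : lmodType R) (f : {linear M -> N}) : bijective f ->
  GC_flat C M -> GC_flat C N.
Proof.
move=> /lin_iso_inverse [g [fK gK]]
  [F [D [dF [e [dD [h1 h2 h3 h4 [j [injj hj]]]]]]]].
exists F, D, dF, e, dD; split=> //; exists (j \o g); split.
  by move=> x y /= /injj /(can_inj gK).
move=> y; rewrite -hj; split=> [[z <-]|[z <-]]; first by exists (g z).
by exists (f z); rewrite /= fK.
Qed.

Lemma FC_flat_iso (C M N : lmodType R) (f : {linear M -> N}) : bijective f ->
  FC_flat C M -> FC_flat C N.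
Proof.
move=> /lin_iso_inverse [g [fK gK]]; apply: IC_injective_retract.
by apply: retract_char; exists g, f.
Qed.

Lemma flat_right_iso (E E' : lmodType R^c) (f : {linear E -> E'}) :
  bijective f ->
  flat_right E -> flat_right E'.
Proof.
move=> /lin_iso_inverse [g [fK gK]] /flat_rightP h;
  apply/flat_rightP => A B i inj b.
have [c hc] := h _ _ i inj (bal_l f b).
exists (bal_l g c); rewrite bal_map_comm hc.
by apply: bal_ext => x y /=; rewrite gK.
Qed.

Lemma flat_right_zero (E : lmodType R^c) :
  (forall x : E, x = 0) -> flat_right E.
Proof.
move=> E0; apply/flat_rightP => A B i inj b; exists 0; apply: bal_ext => x y.
by rewrite (E0 x) !bal0l.
Qed.

End IsoClosed.

Section ModuleDiagrams.
Variable R : pzRingType.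

Lemma ses_prod (A B : lmodType R) :
  exists (i : {linear A -> (A * B)%type}) (p : {linear (A * B)%type -> B}),
    ses i p.
Proof.
have l : linear (fun x : A => (x, 0 : B)).
  by move=> a x y; congr (_, _); rewrite /= scaler0 addr0.
exists (mk_lin l), snd; split=> [x y []|[x y]|y] //.
  by split=> [/= ->|[z [_ <-]]] //; exists x.
by exists (0, y).
Qed.

Lemma projective_prod (P Q : lmodType R) :
  projective P -> projective Q -> projective (P * Q)%type.
Proof.
move=> hP hQ A B p f sp.
have l1 : linear (fun x : P => (x, 0 : Q)).
  by move=> a x y; congr (_, _); rewrite /= scaler0 addr0.
have l2 : linear (fun x : Q => (0 : P, x)).
  by move=> a x y; congr (_, _); rewrite /= scaler0 addr0.
have [g hg] := hP A B p (f \o mk_lin l1) sp.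
have [h hh] := hQ A B p (f \o mk_lin l2) sp.
have l : linear (fun x : P * Q => g x.1 + h x.2).
  by move=> a x y; rewrite /= !linearP scalerDr addrACA.
exists (mk_lin l) => -[x y] /=; rewrite linearD hg hh /= -linearD.
by congr (f (_, _)); rewrite /= ?addr0 ?add0r.
Qed.

(* The preimage of [N <= Y] under a surjection [G -> Y]. *)
Lemma ses_preimage (N Y X K G : lmodType R) (f : {linear N -> Y})
  (g : {linear Y -> X})
    (i : {linear K -> G}) (p : {linear G -> Y}) : ses f g -> ses i p ->
  exists (L : lmodType R) (i' : {linear K -> L}) (p' : {linear L -> N})
    (f' : {linear L -> G}), ses i' p' /\ ses f' (g \o p).
Proof.
move=> [injf efg sg] [inji eip sp].
have [L [f' [injf' ef']]] := @ker_exists R G X (g \o p).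
have [|i' hi'] := @factor_inj R L G K f' i injf'.
  by move=> x; apply/ef'; rewrite /= (exact_comp0 x eip) linear0.
have [|p' hp'] := @factor_inj R N Y L f (p \o f') injf.
  by move=> x; apply/efg; apply: (exact_comp0 x ef').
exists L, i', p', f'; split; split=> //.
- by move=> x y h; apply: inji; rewrite -!hi' h.
- move=> y; split=> [h|[x <-]].
    have /eip [x hx] : p (f' y) = 0.
      by rewrite -[p _]/((p \o f') y) -hp' h linear0.
    by exists x; apply: injf'; rewrite hi'.
  by apply: injf; rewrite hp' /= hi' (exact_comp0 x eip) linear0.
- move=> n; have [y hy] := sp (f n).
  have /ef' [l hl] : (g \o p) y = 0 by rewrite /= hy;
    apply: (exact_comp0 n efg).
  by exists l; apply: injf; rewrite hp' /= hl.
- by move=> x; have [y <-] := sg x; have [z <-] := sp y; exists z.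
Qed.

(** Lifting [g] through [p] gives [h], and [N] is the kernel of the sum of [i] and [h]. As [X] need
    not be projective, Schanuel's lemma takes the form of an exact sequence instead of an
    isomorphism. *)
Lemma ses_schanuel (N P M K X : lmodType R) (f : {linear N -> P})
  (g : {linear P -> M})
    (i : {linear K -> X}) (p : {linear X -> M}) :
  projective P -> ses f g -> ses i p ->
  exists (a : {linear N -> (K * P)%type}) (b : {linear (K * P)%type -> X}),
    ses a b.
Proof.
move=> hP [injf efg sg] [inji eip sp]; have [h hh] := hP _ _ p g sp.
have [|k hk] := @factor_inj R K X N i (h \o f) inji.
  by move=> x; apply/eip; rewrite /= hh; apply: (exact_comp0 x efg).
have la : linear (fun x => (- k x, f x)).
  by move=> a x y; congr (_, _); rewrite /= linearP // opprD -scalerN.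
have lb : linear (fun x : K * P => i x.1 + h x.2).
  by move=> a x y; rewrite /= !linearP scalerDr addrACA.
exists (mk_lin la), (mk_lin lb); split=> [x y [_ /injf]|[x y]|x] //=.
  split=> [e|[n [<- <-]]]; last by rewrite linearN hk addNr.
  have /efg [n hn] : g y = 0.
    by have := congr1 p e; rewrite linearD linear0 hh (exact_comp0 x eip) add0r.
  exists n; congr (_, _) => //; apply: inji.
  by rewrite linearN hk /= hn; apply/eqP; rewrite eq_sym -addr_eq0 e.
have [y hy] := sg (p x).
have /eip [k' hk'] : p (x - h y) = 0 by rewrite linearB hh hy subrr.
by exists (k', y); rewrite /= hk' subrK.
Qed.

End ModuleDiagrams.

(** * Flat dimension through vanishing of Tor *)

Section FlatDimension.
Variable R : pzRingType.

Lemma resn_flat_TorS_eq0 n (E : lmodType R^c) i (M : lmodType R) :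
  resn (@flat_right R) n E -> (n <= i)%N -> TorS_eq0 E i M.
Proof.
elim: n E i => [|n IH] E i /=; first by move=> h _; apply: TorS_eq0_flat_right.
move=> [K [X [f [g [h fX hK]]]]]; case: i => // i ni.
by apply: (TorS_eq0_quot_l h); [apply: IH | apply: TorS_eq0_flat_right].
Qed.

(** The hypothesis is Tor_{n+1}(E, -) = 0. Shifting along a free cover reduces to Tor_1, whose
    vanishing on cokernels keeps injections injective. *)
Lemma TorS_eq0_resn_flat n (E : lmodType R^c) :
  (forall M : lmodType R, TorS_eq0 E n M) -> resn (@flat_right R) n E.
Proof.
elim: n E => [|n IH] E h /=.
  apply/flat_rightP => A B f inj; have [N [p hp]] := ses_of_inj inj.
  exact: (TorS_eq0_surj hp).
have [p sp] := dsum_cover E; have [K [i hi]] := ses_of_surj sp.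
have fP : flat_right (dsum (R^c^o : lmodType R^c) E : lmodType R^c).
  exact/flat_right_dsum/flat_right_regular.
exists K, (dsum R^c^o E), i, p; split=> //; apply: IH => M.
by apply: (TorS_eq0_sub_l hi); [apply: TorS_eq0_flat_right | apply: h].
Qed.

End FlatDimension.

(** * Global dimension *)

Section Dimension.
Variables (R : pzRingType) (C : lmodType R).
Hypothesis hC : w_plus_tilting C.
Hypothesis hext : ext_closed (GC_flat C).
Implicit Types M N K X P : lmodType R.

Lemma GC_resn_TorS_eq0 n M (E : lmodType R^c) i :
  resn (GC_flat C) n M -> IC_injective C E -> (n <= i)%N -> TorS_eq0 E i M.
Proof.
move=> + hE; elim: n M i => [|n IH] M i /=; first by move=> h _;
  apply: GC_TorIC hE _.
move=> [K [X [f [g [h gX hK]]]]]; case: i => // i ni.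
by apply: (TorS_eq0_quot h); [apply: IH | apply: GC_TorIC hE _].
Qed.

(** Characters turn the F_C-resolution of [K] into a finite coresolution of [charmod K] by
    I_{C^+}-injectives, on which Tor with [G] vanishes in all positive degrees. *)
Lemma FC_resn_char_TorS_eq0 m K G (i : nat) :
  resn (FC_flat C) m K -> GC_flat C G -> TorS_eq0 (charmod K) i G.
Proof.
move=> + gG; elim: m K i => [|m IH] K i /=.
  by move=> fK; apply: (GC_TorIC gG).
move=> [L [X [f [g [h fX hL]]]]].
apply: (TorS_eq0_sub_l (char_map_ses h)); first exact: (GC_TorIC gG).
exact: IH.
Qed.

(** The presentation of [M] is pushed out along the hull of its first syzygy: the pushout is an
    extension of G_C-flat modules, and its kernel onto [M] is that hull. *)
Lemma GC_precover_of_hull m :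
  (forall N, resn (GC_flat C) m N -> exists (H G : lmodType R)
     (f : {linear N -> H}) (g : {linear H -> G}),
     [/\ ses f g, resn (FC_flat C) m H & GC_flat C G]) ->
  forall M, resn (GC_flat C) m.+1 M -> exists (H G : lmodType R)
     (f : {linear H -> G}) (g : {linear G -> M}),
     [/\ ses f g, resn (FC_flat C) m H & GC_flat C G].
Proof.
move=> hull M [K [X [i [p [hip gX /hull [H [G' [f [g [hfg fH gG']]]]]]]]]].
have [P [f' [g' [h' [k' [h1 h2 _]]]]]] := ses_pushout hip hfg.
by exists H, P, f', g'; split=> //; apply: (GC_flat_ext hext h2).
Qed.

(** Precovers and hulls alternate: the precover [G] of [N], with kernel [H], is embedded in an
    F_C-flat [X], and [X / H] is the hull, one step longer than [H]. *)
Lemma GC_hull m N : resn (GC_flat C) m N -> exists (H G : lmodType R)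
  (f : {linear N -> H}) (g : {linear H -> G}),
  [/\ ses f g, resn (FC_flat C) m H & GC_flat C G].
Proof.
elim: m N => [|m IH] N hN.
  exact: (GC_cosyzygy hC).
have [H [G [i [p [hip fH gG]]]]] := GC_precover_of_hull IH hN.
have [X [G' [j [q [hjq fX gG']]]]] := GC_cosyzygy hC gG.
have [H' [g' [h' [k' [h1 h2 _]]]]] := ses_noether hip hjq.
exists H', G', h', k'; split=> //.
by exists H, X, (j \o i), g'.
Qed.

Lemma injective_FC_resn m M : injective_mod M ->
  resn (GC_flat C) m.+1 M -> resn (FC_flat C) m.+1 M.
Proof.
move=> injM hM.
have [K [G [i [p [hip fK gG]]]]] := GC_precover_of_hull (@GC_hull m) hM.
have [X [G' [j [q [hjq fX gG']]]]] := GC_cosyzygy hC gG.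
have [H [g' [h' [k' [h1 h2 _]]]]] := ses_noether hip hjq.
have [r hr] := ses_split_retract injM h2.
have fH : resn (FC_flat C) m.+1 H by exists K, X, (j \o i), g'.
(* The F_C-dimension of [M] is not yet bounded, but [M] is a summand of [X / K], whose dimension
   is. *)
have torM n : TorS_eq0 (charmod M) n G'.
  apply: (TorS_eq0_retract_l (E' := charmod H)).
    by apply: retract_char; exists h', r.
  exact: FC_resn_char_TorS_eq0 fH gG'.
(* In the dual sequence [charmod G] lies between [charmod M] and [charmod K]. *)
have torG : TorS_eq0 (charmod G) 0 G'.
  by apply: (TorS_eq0_mid_l (char_map_ses hip)) => //;
    apply: FC_resn_char_TorS_eq0 fK gG'.
(* The identity of [charmod G] is the evaluation pairing with [G]; its extension along [j] to a
   pairing with [X] is a section of [char_map j]. *)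
have [c hc] := TorS_eq0_surj hjq torG (bal_of_lin idfun).
have [t ht] := lin_of_bal c.
exists K, G, i, p; split=> //; apply: IC_injective_retract fX.
exists t, (char_map j) => x; apply: charmod_ext => y /=.
by rewrite ht; apply: (congr1 (fun k => bal_fun k x y) hc).
Qed.

Lemma GC_flat_prod M N : GC_flat C M -> GC_flat C N -> GC_flat C (M * N)%type.
Proof. by have [i [p h]] := ses_prod M N; apply: (GC_flat_ext hext h). Qed.

Lemma resn_GC_prod n K P :
  resn (GC_flat C) n K -> GC_flat C P -> resn (GC_flat C) n (K * P)%type.
Proof.
move=> + gP; case: n => [|n] /=; first by move=> gK; apply: GC_flat_prod.
move=> [L [X [i [p [[inj e sp] gX hL]]]]].
have l1 : linear (fun x => (i x, 0 : P)).
  by move=> a x y; congr (_, _); rewrite /= ?linearP // scaler0 addr0.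
have l2 : linear (fun x : X * P => (p x.1, x.2)).
  by move=> a x y; congr (_, _); rewrite /= linearP.
exists L, (X * P)%type, (mk_lin l1), (mk_lin l2); split=> //;
  last exact: GC_flat_prod.
split=> [x y [/inj]|[x y]|[x y]] //=.
  split=> [[/e [z <-] ->]|[z [<- <-]]]; first by exists z.
  by rewrite (exact_comp0 z e).
by have [z <-] := sp x; exists (z, y).
Qed.

(** Only the first term of the resolution changes: it becomes the preimage of [N], which is the
    kernel of a surjection between G_C-flat modules. *)
Lemma resn_GC_ker n (N Y X : lmodType R) (f : {linear N -> Y})
  (g : {linear Y -> X}) :
  ses f g -> resn (GC_flat C) n Y -> GC_flat C X -> resn (GC_flat C) n N.
Proof.
move=> h + gX; case: n => [|n] /=; first by move=> gY;
  apply: (GC_flat_ker hC hext h).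
move=> [K [G [i [p [hip gG hK]]]]].
have [L [i' [p' [f' [h1 h2]]]]] := ses_preimage h hip.
by exists K, L, i', p'; split=> //; apply: (GC_flat_ker hC hext h2).
Qed.

(** A relation and not a function, because the horseshoe lemma produces particular syzygies. *)
Fixpoint syzygy (n : nat) (S M : lmodType R) : Prop :=
  if n is m.+1 then
    exists (N P : lmodType R) (f : {linear N -> P}) (g : {linear P -> M}),
      [/\ ses f g, GC_projective C P & syzygy m S N]
  else S = M.

Lemma syzygy_exists n M : exists S, syzygy n S M.
Proof.
elim: n M => [|n IH] M; first by exists M.
have [P [p [hP sp]]] := GC_projective_cover hC M.
have [N [i hi]] := ses_of_surj sp; have [S hS] := IH N.
by exists S, N, P, i, p.
Qed.

Lemma syzygy_resn n S M : syzygy n S M -> GC_flat C S -> resn (GC_flat C) n M.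
Proof.
elim: n M => [|n IH] M /=; first by move=> ->.
move=> [N [P [f [g [h [_ gP] hS]]]]] gS; exists N, P, f, g; split=> //.
exact: IH.
Qed.

(** Schanuel's lemma makes [N] the kernel of a surjection from [K * P] onto [X]. Neither the product
    with [P] nor such a kernel spoils the bound on [K]. *)
Lemma syzygy_GC n S M : resn (GC_flat C) n M -> syzygy n S M -> GC_flat C S.
Proof.
elim: n M => [|n IH] M /=; first by move=> gM ->.
move=> [K [X [i [p [hip gX hK]]]]] [N [P [f [g [h [prP gP] hS]]]]].
have [a [b hab]] := ses_schanuel prP h hip.
by apply: IH hS; apply: (resn_GC_ker hab) => //; apply: resn_GC_prod.
Qed.

Lemma syzygy_TorS_eq0 n S M (E : lmodType R^c) :
  IC_injective C E -> syzygy n S M ->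
  (forall i, (n <= i)%N -> TorS_eq0 E i M) -> forall i, TorS_eq0 E i S.
Proof.
move=> hE; elim: n M => [|n IH] M /=; first by move=> -> h i; apply: h.
move=> [N [P [f [g [h [_ gP] hS]]]]] tor; apply: (IH _ hS) => i ni.
by apply: (TorS_eq0_sub h); [apply: GC_TorIC hE _ | apply: tor].
Qed.

(** The cover of [A] is prescribed and that of [D] is chosen; lifting the latter to [B] gives the
    cover [P * Q] of [B], and the three kernels form a short exact sequence. *)
Lemma horseshoe_step (A B D N P : lmodType R) (f : {linear A -> B})
  (g : {linear B -> D})
    (i : {linear N -> P}) (p : {linear P -> A}) :
  ses f g -> ses i p -> GC_projective C P ->
  exists (NB ND : lmodType R) (u : {linear N -> NB}) (v : {linear NB -> ND}),
  [/\ ses u v,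
      exists (Q : lmodType R) (iB : {linear NB -> Q}) (pB : {linear Q -> B}),
        ses iB pB /\ GC_projective C Q &
      exists (Q : lmodType R) (iD : {linear ND -> Q}) (pD : {linear Q -> D}),
        ses iD pD /\ GC_projective C Q].
Proof.
move=> [injf efg sg] [inji eip sp] [prP gP].
have [Q [c [[prQ gQ] sc]]] := GC_projective_cover hC D.
have [ND [iD hD]] := ses_of_surj sc; have [injD eD _] := hD.
have [l hl] := prQ _ _ g c sg.
have lb : linear (fun x : P * Q => f (p x.1) + l x.2).
  by move=> a x y; rewrite /= !linearP scalerDr addrACA.
have sb : surj (mk_lin lb).
  move=> b; have [y hy] := sc (g b).
  have /efg [a ha] : g (b - l y) = 0 by rewrite linearB hl hy subrr.
  by have [x hx] := sp a; exists (x, y); rewrite /= hx ha subrK.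
have [NB [iB hB]] := ses_of_surj sb; have [injB eB _] := hB.
have li : linear (fun x => (i x, 0 : Q)).
  by move=> a x y; congr (_, _); rewrite /= ?linearP // scaler0 addr0.
have [|u hu] := @factor_inj R NB _ N iB (mk_lin li) injB.
  by move=> x; apply/eB; rewrite /= (exact_comp0 x eip) !linear0 addr0.
have [|v hv] := @factor_inj R ND Q NB iD (snd \o iB) injD.
  move=> x; apply/eD; have := congr1 g (exact_comp0 x eB).
  by rewrite /= linearD linear0 hl (exact_comp0 _ efg) add0r.
exists NB, ND, u, v; split.
- split.
  + by move=> x y h; have := congr1 iB h; rewrite !hu => -[/inji].
  + move=> y; split=> [h|[x <-]]; last by apply: injD;
    rewrite hv /= hu /= linear0.
    have y2 : (iB y).2 = 0 by rewrite -[LHS]/((snd \o iB) y) -hv h linear0.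
    have /eip [n hn] : p (iB y).1 = 0.
      apply: injf; rewrite linear0.
      by have := exact_comp0 y eB; rewrite /= y2 linear0 addr0.
    by exists n; apply: injB; rewrite hu /= hn [RHS]surjective_pairing y2.
  + move=> y; have /efg [a ha] : g (l (iD y)) = 0 by rewrite hl;
    apply: (exact_comp0 y eD).
    have [x hx] := sp a.
    have /eB [z hz] : mk_lin lb (- x,
      iD y) = 0 by rewrite /= !linearN hx ha addNr.
    by exists z; apply: injD; rewrite hv /= hz.
- exists (P * Q)%type, iB, (mk_lin lb); split=> //; split.
    exact: projective_prod.
  exact: GC_flat_prod.
- by exists Q, iD, c.
Qed.

Lemma horseshoe n S (A B D : lmodType R) (f : {linear A -> B})
  (g : {linear B -> D}) :
  ses f g -> syzygy n S A ->
  exists (SB SD : lmodType R) (u : {linear S -> SB}) (v : {linear SB -> SD}),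
  [/\ ses u v, syzygy n SB B & syzygy n SD D].
Proof.
elim: n A B D f g => [|n IH] A B D f g h /=; first by move=> ->;
  exists B, D, f, g.
move=> [N [P [i [p [hip hP hS]]]]].
have [NB [ND [u [v [huv [Q [iB [pB [hB hQ]]]] [Q' [iD [pD [hD hQ']]]]]]]]] :=
  horseshoe_step h hip hP.
have [SB [SD [u' [v' [huv' hSB hSD]]]]] := IH _ _ _ _ _ huv hS.
exists SB, SD, u', v'; split=> //.
  by exists NB, Q, iB, pB.
by exists ND, Q', iD, pD.
Qed.

Lemma GC_resn_all n :
  (forall E : lmodType R^c, IC_injective C E -> resn (@flat_right R) n E) ->
  (forall J : lmodType R, injective_mod J -> resn (GC_flat C) n J) ->
  forall M, resn (GC_flat C) n M.
Proof.
move=> hfd hinj M.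
pose Sy S := exists M, syzygy n S M.
have SyTor S : Sy S -> TorIC C S.
  move=> [M' hS] E hE; apply: (syzygy_TorS_eq0 hE hS) => i ni.
  exact: resn_flat_TorS_eq0 (hfd E hE) ni.
have SyStep S : Sy S -> exists (Q S' : lmodType R) (f : {linear S -> Q})
    (g : {linear Q -> S'}), [/\ ses f g, GC_flat C Q & Sy S'].
  move=> [M' hS]; have [J [i [injJ inji]]] := enough_injectives M'.
  have [N [p hip]] := ses_of_inj inji.
  have [SJ [SN [u [v [huv hSJ hSN]]]]] := horseshoe hip hS.
  exists SJ, SN, u, v; split=> //; last by exists N.
  exact: syzygy_GC (hinj J injJ) hSJ.
have [S hS] := syzygy_exists n M; apply: (syzygy_resn hS).
(* Syzygies are only known to embed in G_C-flat modules, while coinduction asks for F_C-flat ones.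
   The class therefore consists of all modules that embed in a G_C-flat [Q] with a syzygy as
   cokernel. *)
apply: (@GC_coind R C (fun N => exists (Q M' : lmodType R) (f : {linear N -> Q})
   (g : {linear Q -> M'}), [/\ ses f g, GC_flat C Q & Sy M'])).
- move=> N [Q [M' [f [g [h gQ sM]]]]] E hE i.
  by apply: (TorS_eq0_sub h); [apply: GC_TorIC hE _ | apply: SyTor].
- move=> N [Q [M' [f [g [h gQ sM]]]]].
  have [X [G' [j [q [hjq fX gG']]]]] := GC_cosyzygy hC gQ.
  (* [N'] is [X / N]; it contains the syzygy [M'] with quotient [G']. *)
  have [N' [g1 [h' [k' [h1 h2 _]]]]] := ses_noether h hjq.
  have [Q' [M'' [a [b [hab gQ' sM'']]]]] := SyStep _ sM.
  (* Gluing [N'] and [Q'] along [M'] gives an extension [P] of [G'] by [Q'], hence a G_C-flat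
     module, and [P / N'] is the syzygy [M'']: so [N'] is in the class again. *)
  have [P [f' [g' [h'' [k'' [h3 h4 _]]]]]] := ses_pushout hab h2.
  exists X, N', (j \o f), g1; split=> //.
  exists P, M'', f', g'; split=> //.
  exact: (GC_flat_ext hext h4).
- by apply: SyStep; exists M.
Qed.

End Dimension.

Theorem theoremA (R : pzRingType) (C : lmodType R)
    (hC : w_plus_tilting C) (hext : ext_closed (GC_flat C))
    (n : nat) (hn : (0 < n)%N) :
  [<-> dim_le (GC_FD C) n ;
       (forall E : lmodType R^c,
          IC_injective C E -> dim_le (flat_dim_right E) n) /\
       (forall M : lmodType R, injective_mod M -> dim_le (FC_fd C M) n) ;
       (forall E : lmodType R^c,
          IC_injective C E -> dim_le (flat_dim_right E) n) /\
       (forall M : lmodType R, injective_mod M -> dim_le (GC_fd C M) n) ].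
Proof.
have fdE (E : lmodType R^c) := dim_le_resdim (@flat_right_iso R)
  (@flat_right_zero R) E n.
have fcE M := dim_le_resdim (@FC_flat_iso R C) (@FC_flat_zero R C) M n.
have gcE M := dim_le_resdim (@GC_flat_iso R C) (GC_flat_zero hC) M n.
tfae.
- move/dim_le_sup => h; have gc M : resn (GC_flat C) n M by apply/gcE/h.
  split=> [E hE|M injM].
    by apply/fdE/TorS_eq0_resn_flat => M; apply: (GC_resn_TorS_eq0 (gc M)).
  (* Writing [n] as [m.+1] leaves one step for the kernel of the G_C-flat precover, of F_C-dimension
     at most [m]. *)
  apply/fcE; case: n hn gc {h fdE fcE gcE} => // m _ gc.
  exact: injective_FC_resn (gc M).
- move=> [fd fc]; split=> // M /fc /fcE h; apply/gcE.
  elim: n M h {hn fdE fcE gcE fd fc} => [|m IH] M /=; first exact: FC_GC.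
  by move=> [K [X [f [g [h /(FC_GC hC) gX /IH hK]]]]]; exists K, X, f, g.
- move=> [fd gc]; apply/dim_le_sup => M; apply/gcE;
  apply: (GC_resn_all hC hext).
    by move=> E /fd /fdE.
  by move=> J /gc /gcE.
Qed.
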